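(* Let $p$ be a prime and $G$ an abelian $p$-group. Then $G$ is semi-generalized Bassian if, and only if, one of the following holds: (1) $G$ is divisible; (2) $G$ has finite $p$-rank (i.e., $G[p]$ is finite); (3) for some positive integer $n$, $G \cong G' \oplus F$, where $G' \cong \big(\bigoplus_I \mathbb{Z}_{p^n}\big) \oplus \big(\bigoplus_J \mathbb{Z}_{p^{n+1}}\big)$ for some index sets $I, J$, and $F$ is a finite subgroup with $F[p] \subseteq (p^{n+1}G)[p]$.
   Context: All groups are additively written abelian groups; $\mathbb{Z}_{p^k}$ is the cyclic group of order $p^k$; for a group $A$, $A[p] = \{a \in A : pa = 0\}$. A subgroup $H$ of a group $A$ is essential in $A$ if $H \cap S \neq \{0\}$ for every non-zero subgroup $S$ of $A$. A group $G$ is semi-generalized Bassian if, for every subgroup $H \le G$, the existence of an injective homomorphism $G \to G/H$ implies that $H$ is an essential subgroup of some direct summand of $G$. *)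

(* Defs.v *)
From HB Require Import structures.
From mathcomp Require Import all_boot all_algebra.
From Stdlib Require List.
Set Implicit Arguments. Unset Strict Implicit. Unset Printing Implicit Defensive.
Import GRing.Theory.
Local Open Scope ring_scope.

Section Defs.
Variable G : zmodType.

Definition subgroup (H : G -> Prop) : Prop :=
  H 0 /\ (forall x y, H x -> H y -> H (x - y)).

Definition nonzero_grp (S : G -> Prop) : Prop := exists s, S s /\ s <> 0.

Definition essential (H A : G -> Prop) : Prop :=
  forall S : G -> Prop, subgroup S -> (forall x, S x -> A x) -> nonzero_grp S ->
    exists s, S s /\ H s /\ s <> 0.

Definition int_direct_sum (A B : G -> Prop) : Prop :=
  subgroup A /\ subgroup B /\ (forall x, A x -> B x -> x = 0) /\
  (forall x, exists a b, A a /\ B b /\ x = a + b).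

Definition direct_summand (D : G -> Prop) : Prop :=
  exists C : G -> Prop, int_direct_sum D C.

(* A homomorphism G -> G/H, presented by a choice of coset representatives
   f x (a function G -> G/H is exactly such a choice, up to H). *)
Definition hom_to_quot (H : G -> Prop) (f : G -> G) : Prop :=
  forall x y, H (f (x + y) - (f x + f y)).

Definition inj_to_quot (H : G -> Prop) (f : G -> G) : Prop :=
  forall x y, H (f x - f y) -> x = y.

Definition semi_generalized_bassian : Prop :=
  forall H : G -> Prop, subgroup H ->
    (exists f : G -> G, hom_to_quot H f /\ inj_to_quot H f) ->
    exists D : G -> Prop, subgroup D /\ direct_summand D /\
      (forall x, H x -> D x) /\ essential H D.

Definition p_group (p : nat) : Prop := forall x : G, exists k, x *+ (p ^ k) = 0.

Definition divisible : Prop := forall (x : G) (n : nat), (0 < n)%N -> exists y, y *+ n = x.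

Definition finite_set (A : G -> Prop) : Prop := exists s : seq G, forall x, A x -> x \in s.

Definition finite_p_rank (p : nat) : Prop := finite_set (fun x => x *+ p = 0).

(* The external direct sum  (+)_{k : K} Z_{m k}, modelled concretely:
   elements are finitely supported c : K -> nat with c k < m k,
   and addition is coordinatewise mod m k. *)
Definition dsum_elem (K : Type) (m : K -> nat) (c : K -> nat) : Prop :=
  (forall k, (c k < m k)%N) /\ exists s : list K, forall k, c k <> 0%N -> List.In k s.

Definition dsum_add (K : Type) (m : K -> nat) (c d : K -> nat) : K -> nat :=
  fun k => ((c k + d k) %% m k)%N.

Definition iso_to_dsum (A : G -> Prop) (K : Type) (m : K -> nat) : Prop :=
  exists Phi : (K -> nat) -> G,
    (forall c, dsum_elem m c -> A (Phi c)) /\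
    (forall c d, dsum_elem m c -> dsum_elem m d -> Phi (dsum_add m c d) = Phi c + Phi d) /\
    (forall c d, dsum_elem m c -> dsum_elem m d -> Phi c = Phi d -> c = d) /\
    (forall a, A a -> exists c, dsum_elem m c /\ Phi c = a).

Definition two_orders (p n : nat) (I J : Type) (k : I + J) : nat :=
  match k with inl _ => (p ^ n)%N | inr _ => (p ^ n.+1)%N end.

Definition condition3 (p : nat) : Prop :=
  exists n : nat, (0 < n)%N /\
    exists (G' F : G -> Prop) (I J : Type),
      int_direct_sum G' F /\
      iso_to_dsum G' (@two_orders p n I J) /\
      finite_set F /\
      (forall y, F y -> y *+ p = 0 -> exists x : G, y = x *+ (p ^ n.+1)).

End Defs.

(* Main.v *)
(* Sufficiency. Inside a divisible group, a maximal essential extension [D] of [H] is divisible,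
   hence a summand.  If [G[p]] is finite, counting the elements of [G[p^j]] shows that an embedding
   [G -> G/H] forces [H] into [p^j G] for all [j], hence into the divisible part.  In case (3) the
   finiteness of [p^(n+1) G] forces [H] to meet it trivially; as [G[p]] lies in [p^(n-1) G], a
   maximal essential extension of [H] in [G] is then pure and bounded, hence a summand.

   Necessity. Choose [x] outside [p G] of minimal order [p^a].  A subgroup [H] containing some
   [x + p y] with [H[p]] inside [p^a G] is never essential in a summand, because purity of the
   summand would produce a socle element of height exactly [a - 1].  Such an [H] with [G] embedded
   in [G/H] is found
   - if all the [(p^k G)[p]] are infinite: inside a countable direct sum [M] of cyclic groups, with
     [M/H] divisible of infinite rank; an embedding of [M] in [M/H] extends to [G] by divisibility;
   - if [(p^(k-1) G)[p]] is infinite and [(p^k G)[p]] finite with [k >= a + 2], or [G] is not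
     bounded: by shifting a summand that is an infinite sum of copies of [Z(p^k)].
   Otherwise [G] is bounded, [(p^(a+1) G)[p]] is finite, and (3) holds with [n = a]: [G'] is a
   subgroup maximal subject to meeting [p^(a+1) G] trivially. *)
Require Import Defs.
From HB Require Import structures.
From mathcomp Require Import all_boot all_order all_algebra.
From mathcomp Require Import boolp classical_sets.
From mathcomp Require Import zify.
Set Implicit Arguments. Unset Strict Implicit. Unset Printing Implicit Defensive.
Import GRing.Theory.
Local Open Scope ring_scope.

(** * Subgroups and Zorn's lemma *)

Section Subgroups.
Variable V : zmodType.
Implicit Types (H D : V -> Prop) (x y : V).

Lemma subgroup_opp H x : subgroup H -> H x -> H (- x).
Proof. by move=> [H0 HB] Hx; rewrite -(sub0r x); apply: HB. Qed.

Lemma subgroup_add H x y : subgroup H -> H x -> H y -> H (x + y).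
Proof.
by move=> sH Hx Hy; rewrite -(opprK y); apply: sH.2 => //; apply: subgroup_opp.
Qed.

Lemma subgroup_muln H x n : subgroup H -> H x -> H (x *+ n).
Proof.
move=> sH Hx; elim: n => [|n IHn]; first by rewrite mulr0n; apply: sH.1.
by rewrite mulrS; apply: subgroup_add.
Qed.

Lemma subgroup_mulz H x (a : int) : subgroup H -> H x -> H (x *~ a).
Proof.
move=> sH Hx; case: a => n; rewrite ?NegzE ?mulrNz -pmulrn.
  exact: subgroup_muln.
by apply: subgroup_opp => //; apply: subgroup_muln.
Qed.

Lemma subgroup_sum H (I : Type) (s : seq I) (P : pred I) (F : I -> V) :
  subgroup H -> (forall i, P i -> H (F i)) -> H (\sum_(i <- s | P i) F i).
Proof.
by move=> sH HF; elim/big_ind: _ => // [|u v]; [apply: sH.1|apply: subgroup_add].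
Qed.

Definition adjoin D x : V -> Prop := fun z => exists d (a : int), D d /\ z = d + x *~ a.

Lemma adjoin_subgroup D x : subgroup D -> subgroup (adjoin D x).
Proof.
move=> sD; split; first by exists 0, 0; rewrite mulr0z addr0; split=> //; apply: sD.1.
move=> _ _ [d [a [Dd ->]]] [e [b [De ->]]].
by exists (d - e), (a - b); rewrite mulrzBr opprD addrACA; split=> //; apply: sD.2.
Qed.

Lemma subgroup_zero : subgroup (fun x : V => x = 0).
Proof. by split=> // x y -> ->; rewrite subrr. Qed.

(** Zorn's lemma; the last clause is maximality tested on the one-generator extensions
    [adjoin D x]. *)
Lemma maximal_subgroup H (Q : V -> Prop) : subgroup H -> (forall x, H x -> Q x) ->
  exists D, [/\ subgroup D, forall x, H x -> D x, forall x, D x -> Q x &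
    forall x, (forall d a, D d -> Q (d + x *~ a)) -> D x].
Proof.
move=> sH HQ.
pose good D := [/\ subgroup D, forall x, H x -> D x & forall x, D x -> Q x].
(* The union over an empty chain is empty and must satisfy [P], whence the first disjunct. *)
pose P (X : set V) := X = set0 \/ good X.
have [F FP totF|D [PD maxD]] := @Zorn_bigcup V P.
  case: (pselect (exists2 X, F X & good X)) => [[X FX gX]|noX]; last first.
    left; apply/seteqP; split=> // x [X FX Xx].
    by case: (FP _ FX) => [X0|gX]; [rewrite X0 in Xx | apply: noX; exists X].
  have gF Y y : F Y -> Y y -> good Y.
    by move=> FY Yy; case: (FP _ FY) => // Y0; rewrite Y0 in Yy.
  right; split=> [|x Hx|x [Y FY Yx]]; last by have [_ _] := gF _ _ FY Yx; apply.
    split=> [|x y [Y FY Yx] [Z FZ Zy]]; first by exists X => //; case: gX => -[].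
    have [YZ|ZY] := totF _ _ FY FZ.
      by exists Z => //; have [sZ _ _] := gF _ _ FZ Zy; apply: sZ.2 => //; apply: YZ.
    by exists Y => //; have [sY _ _] := gF _ _ FY Yx; apply: sY.2 => //; apply: ZY.
  by exists X => //; have [_ HX _] := gX; apply: HX.
have gH : good H by [].
have gD : good D.
  case: PD => // D0; case: (maxD H); last by right.
  rewrite D0; split=> // H0; exact: (H0 0 sH.1).
have [sD HD DQ] := gD; exists D; split=> // x Qx.
apply: contrapT => nDx; apply: (maxD (adjoin D x)); last first.
  right; split; first exact: adjoin_subgroup.
    by move=> y Hy; exists y, 0; rewrite mulr0z addr0; split=> //; apply: HD.
  by move=> y [d [a [Dd ->]]]; apply: Qx.
split=> [y Dy|sub]; first by exists y, 0; rewrite mulr0z addr0.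
by apply: nDx; apply: sub; exists 0, 1; rewrite add0r; split=> //; apply: sD.1.
Qed.

End Subgroups.

(** * The free abelian group on [nat] *)

Section Evaluation.
Implicit Types q r : {poly int}.

(* [ev y] is the homomorphism from the free abelian group on [nat], modelled by [{poly int}],
   that sends the [i]-th generator ['X^i] to [y i]. *)
Definition ev (V : zmodType) (y : nat -> V) (q : {poly int}) : V :=
  \sum_(i < size q) y i *~ q`_i.

Lemma ev_widen (V : zmodType) (y : nat -> V) q n : (size q <= n)%N ->
  ev y q = \sum_(i < n) y i *~ q`_i.
Proof.
move=> qn; rewrite /ev (big_ord_widen n (fun i => y i *~ q`_i) qn) big_mkcond /=.
by apply: eq_bigr => i _; case: ltnP => // iq; rewrite nth_default // mulr0z.
Qed.

Lemma ev_sub (V : zmodType) (y : nat -> V) : {morph ev y : q r / q - r}.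
Proof.
move=> q r; pose n := maxn (size (q - r)) (maxn (size q) (size r)).
rewrite !(@ev_widen _ _ _ n) /n ?leq_max ?leqnn ?orbT // -sumrB.
by apply: eq_bigr => i _; rewrite coefB mulrzBr.
Qed.

HB.instance Definition _ (V : zmodType) (y : nat -> V) :=
  GRing.isZmodMorphism.Build {poly int} V (ev y) (ev_sub y).

Lemma ev0 (V : zmodType) (y : nat -> V) : ev y 0 = 0.
Proof. exact: raddf0. Qed.

Lemma evMn (V : zmodType) (y : nat -> V) q n : ev y (q *+ n) = ev y q *+ n.
Proof. exact: raddfMn. Qed.

Lemma evXn (V : zmodType) (y : nat -> V) k : ev y 'X^k = y k.
Proof.
rewrite /ev size_polyXn big_ord_recr /= big1 ?add0r ?coefXn ?eqxx //.
by move=> i _; rewrite coefXn (ltn_eqF (ltn_ord i)) mulr0z.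
Qed.

Lemma ev_ev (V : zmodType) (y : nat -> V) (R : nat -> {poly int}) q :
  ev y (ev R q) = ev (fun i => ev y (R i)) q.
Proof. by rewrite {2}/ev raddf_sum; apply: eq_bigr => i _; rewrite raddfMz. Qed.

Definition reindex (f : nat -> nat) q : {poly int} := ev (fun i => 'X^(f i)) q.

Lemma ev_eq (V : zmodType) (y z : nat -> V) q r :
  (forall i, y i *~ q`_i = z i *~ r`_i) -> ev y q = ev z r.
Proof.
move=> E; pose n := maxn (size q) (size r).
by rewrite !(@ev_widen _ _ _ n) /n ?leq_max ?leqnn ?orbT //; apply: eq_bigr.
Qed.

Lemma ev_reindex (V : zmodType) (y : nat -> V) f q :
  ev y (reindex f q) = ev (fun i => y (f i)) q.
Proof. by rewrite ev_ev; apply: ev_eq => i; rewrite evXn. Qed.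

Lemma ev_subgroup (V : zmodType) (y : nat -> V) q H : subgroup H ->
  (forall i, H (y i *~ q`_i)) -> H (ev y q).
Proof. by move=> sH Hy; apply: subgroup_sum. Qed.

End Evaluation.

(** * Elements and subgroups of a [p]-group *)

Section PGroup.
Variables (p : nat) (G : zmodType).
Hypotheses (p_pr : prime p) (pG : p_group G p).
Implicit Types (H D C A W : G -> Prop) (x y z : G).

Definition pmul D k : G -> Prop := fun x => exists2 y, D y & x = y *+ p ^ k.
Definition pow k : G -> Prop := fun x => exists y, x = y *+ p ^ k.

Lemma mulrnXX x k l : x *+ p ^ k *+ p ^ l = x *+ p ^ (k + l).
Proof. by rewrite expnD mulrnA. Qed.

Lemma mulrnX1 x k : x *+ p ^ k *+ p = x *+ p ^ k.+1.
Proof. by rewrite expnSr mulrnA. Qed.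

Lemma mulrn1X x k : x *+ p *+ p ^ k = x *+ p ^ k.+1.
Proof. by rewrite expnS mulrnA. Qed.

Lemma pow_subgroup k : subgroup (pow k).
Proof.
split; first by exists 0; rewrite mul0rn.
by move=> _ _ [x ->] [y ->]; exists (x - y); rewrite mulrnBl.
Qed.

Lemma pow_le k l x : (k <= l)%N -> pow l x -> pow k x.
Proof. by move=> /subnK <- [y ->]; exists (y *+ p ^ (l - k)); rewrite mulrnXX. Qed.

Lemma pow_mul k l x : pow k x -> pow (k + l) (x *+ p ^ l).
Proof. by move=> [y ->]; exists y; rewrite mulrnXX. Qed.

Lemma powX k x : pow k (x *+ p ^ k). Proof. by exists x. Qed.

Lemma pow0 x : pow 0 x. Proof. by exists x. Qed.

Lemma expn_mulz x k (a : int) : x *~ a *+ p ^ k = x *+ p ^ k *~ a.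
Proof. by rewrite !pmulrn -!mulrzA mulrC. Qed.

Lemma mulrz_pM x (a : int) : x *~ (p%:Z * a) = x *+ p *~ a.
Proof. by rewrite mulrzA pmulrn. Qed.

(* Modulo [D] the multiples of [x] form an [F_p]-line. *)
Lemma mulz_unit D x (a : int) :
  subgroup D -> D (x *+ p) -> ~~ (p%:Z %| a)%Z -> D (x *~ a) -> D x.
Proof.
move=> sD Dpx pa Dax.
have /coprimezP[[u v] /= uv] : coprimez p%:Z a.
  by rewrite /coprimez /gcdz eqz_nat -/(coprime _ _) prime_coprime.
rewrite -(mulr1z x) -uv mulrzDr; apply: subgroup_add => //.
  by rewrite mulrC mulrzA -pmulrn; apply: subgroup_mulz.
by rewrite mulrC mulrzA; apply: subgroup_mulz.
Qed.

(** The sequence [z], [p z], [p^2 z], ... ends at 0, so some step enters [D]. With [D = {0}] this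
    yields a non-zero socle element, with a subgroup [D] an element of order [p] modulo [D]. *)
Lemma torsion_ladder D z : D 0 -> ~ D z ->
  exists i, ~ D (z *+ p ^ i) /\ D (z *+ p ^ i *+ p).
Proof.
move=> D0 nDz; have [k zk] := pG z.
have: D (z *+ p ^ k) by rewrite zk.
elim: k {zk} => [|k IHk] Dk; first by case: nDz; move: Dk; rewrite expn0 mulr1n.
have [Dk'|nDk] := pselect (D (z *+ p ^ k)); first exact: IHk.
by exists k; rewrite mulrnX1.
Qed.

Lemma torsion_ladder_sub D z : subgroup D -> ~ D z ->
  exists z', ~ D z' /\ D (z' *+ p).
Proof. by move=> sD /(torsion_ladder sD.1)[i zi]; exists (z *+ p ^ i). Qed.

Lemma order_dvd z m (a : int) : z *+ p ^ m = 0 -> (0 < m)%N -> z *+ p ^ m.-1 <> 0 ->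
  z *~ a = 0 -> ((p ^ m)%:Z %| a)%Z.
Proof.
move=> zm m_gt0 zm1 za.
suff: forall j, (j <= m)%N -> ((p ^ j)%:Z %| a)%Z by apply.
elim=> [|j IHj] jm; first by rewrite expn0 dvd1z.
have /dvdzP[b ab] := IHj (ltnW jm).
rewrite ab expnS PoszM dvdz_mul //.
apply/negPn/negP => pb; apply: zm1.
apply: (@mulz_unit (fun x => x = 0) _ b) => //; first exact: subgroup_zero.
  by rewrite mulrnX1 prednK.
have -> : m.-1 = (m.-1 - j + j)%N by rewrite subnK // -ltnS prednK.
rewrite addnC -mulrnXX -expn_mulz.
by rewrite [z *+ _]pmulrn -mulrzA mulrC -ab za mul0rn.
Qed.

Lemma divisible_of_p : (forall x, pow 1 x) -> divisible G.
Proof.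
move=> dp x n n_gt0.
have dpk k : forall z, exists y, z = y *+ p ^ k.
  elim: k => [|k IHk] z; first by exists z.
  have [y ->] := IHk z; have [u ->] := dp y.
  by exists u; rewrite mulrnXX add1n.
have [y xy] := dpk (logn p n) x.
have [l yl] := pG y.
have := partnC p n_gt0; rewrite p_part => nE.
(* The prime-to-[p] part of [n] is invertible modulo [p^l], which kills [y]; [u] is its inverse. *)
have /coprimezP[[u v] /= uv] : coprimez (n`_p^')%:Z (p ^ l)%:Z.
  rewrite /coprimez /gcdz eqz_nat -/(coprime _ _) coprime_sym coprimeXl //.
  exact: pnat_coprime (pnat_id p_pr) (part_pnat _ _).
exists (y *~ u); rewrite -nE mulrnA expn_mulz -xy.
have xl : x *+ p ^ l = 0 by rewrite xy -mulrnA mulnC mulrnA yl mul0rn.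
have xvl : x *~ (v * (p ^ l)%:Z) = 0 by rewrite mulrC mulrzA -pmulrn xl mul0rz.
by rewrite -[RHS]mulr1z -uv mulrzDr xvl addr0 mulrzA pmulrn.
Qed.

(** * Neat and pure subgroups *)

Definition sumg D C : G -> Prop := fun x => exists a b, D a /\ C b /\ x = a + b.

Lemma sumg_subgroup D C : subgroup D -> subgroup C -> subgroup (sumg D C).
Proof.
move=> sD sC; split; first by exists 0, 0; rewrite addr0; do !split=> //; [apply: sD.1 | apply: sC.1].
move=> _ _ [a [b [Da [Cb ->]]]] [a' [b' [Da' [Cb' ->]]]].
exists (a - a'), (b - b'); split; first exact: sD.2.
by split; [apply: sC.2 | rewrite opprD addrACA].
Qed.

Lemma sumgl D C x : subgroup C -> D x -> sumg D C x.
Proof. by move=> sC Dx; exists x, 0; rewrite addr0; do !split=> //; apply: sC.1. Qed.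

Lemma sumgr D C x : subgroup D -> C x -> sumg D C x.
Proof. by move=> sD Cx; exists 0, x; rewrite add0r; do !split=> //; apply: sD.1. Qed.

Lemma pmul_subgroup D k : subgroup D -> subgroup (pmul D k).
Proof.
move=> sD; split; first by exists 0; rewrite ?mul0rn //; apply: sD.1.
by move=> _ _ [x Dx ->] [y Dy ->]; exists (x - y); rewrite ?mulrnBl //; apply: sD.2.
Qed.

(** [D] is maximal among the subgroups between [H] and [A] with socle inside [W]. It is neat: were
    [p y] in [D] but not in [p D], any [d + a y] killed by [p] would have [p] dividing [a], hence
    lie in [D], and [y] could be adjoined. With [W = H], this is a maximal essential extension of
    [H] in [A]. *)
Lemma neat_hull A H W : subgroup A -> subgroup H -> (forall x, H x -> A x) ->
  (forall x, H x -> x *+ p = 0 -> W x) ->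
  exists D, [/\ subgroup D /\ (forall x, H x -> D x), forall x, D x -> A x,
    forall x, D x -> x *+ p = 0 -> W x,
    forall y, A y -> D (y *+ p) -> exists2 d, D d & y *+ p = d *+ p &
    forall t, A t -> (forall d a, D d -> (d + t *~ a) *+ p = 0 -> W (d + t *~ a)) -> D t].
Proof.
move=> sA sH HA HW.
have [|D [sD HD DQ maxD]] :=
  @maximal_subgroup _ H (fun x => A x /\ (x *+ p = 0 -> W x)) sH.
  by move=> x Hx; split; [apply: HA | apply: HW].
have DA x : D x -> A x by move=> /DQ[].
have DW x : D x -> x *+ p = 0 -> W x by move=> /DQ[].
have Aadd d t a : A t -> D d -> A (d + t *~ a).
  by move=> At Dd; apply: subgroup_add => //; [apply: DA | apply: subgroup_mulz].
exists D; split=> // [y Ay Dpy|t At Wt]; last first.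
  by apply: maxD => d a Dd; split; [apply: Aadd | apply: Wt].
case: (pselect (pmul D 1 (y *+ p))) => [[d Dd ->]|npD]; first by exists d; rewrite ?expn1.
exists y => //; apply: maxD => d a Dd; split; first exact: Aadd.
have [/dvdzP[b ->]|pa] := boolP (p%:Z %| a)%Z.
  by apply: DW; apply: subgroup_add => //; rewrite mulrC mulrz_pM; apply: subgroup_mulz.
move=> e0; case: npD; apply: (mulz_unit (pmul_subgroup 1 sD) _ pa).
  by exists (y *+ p); rewrite ?expn1.
exists (- d); first exact: subgroup_opp.
apply/eqP; rewrite mulNrn -addr_eq0 addrC -(expn1 p) -expn_mulz -mulrnDl expn1.
exact/eqP.
Qed.

(** Induction on the height. If [d = p^(k+1) y] with [k < n], neatness gives [d = p e] with [e] in
    [D]; then [e - p^k y] is in the socle, hence in [p^k G], and so is [e]. Beyond height [n] only 0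
    remains in [D]. *)
Lemma neat_pure n D : (forall x, x *+ p = 0 -> pow n.-1 x) -> subgroup D ->
  (forall y, D (y *+ p) -> exists2 d, D d & y *+ p = d *+ p) ->
  (forall x, D x -> pow n.+1 x -> x = 0) ->
  forall k d, D d -> pow k d -> pmul D k d.
Proof.
move=> socn sD neat Dn; elim=> [|k IHk] d Dd; first by exists d.
have [lt_nk pd|le_kn] := ltnP n k.+1.
  rewrite (Dn d Dd (pow_le lt_nk pd)).
  by exists 0; rewrite ?mul0rn //; apply: sD.1.
move=> [y dy]; rewrite -mulrnX1 in dy.
have [|e De dE] := neat (y *+ p ^ k); first by rewrite -dy.
have pke : pow k e.
  rewrite -(subrK (y *+ p ^ k) e); apply: subgroup_add (powX _ _); first exact: pow_subgroup.
  apply: (@pow_le _ n.-1); first by rewrite -ltnS (ltn_predK le_kn).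
  by apply: socn; rewrite mulrnBl -dE subrr.
have [e' De' eE] := IHk e De pke; exists e' => //.
by rewrite dy dE eE mulrnX1.
Qed.

(** Let [C] be maximal disjoint from [D]. If [z] is outside [D + C] with [p z = d + c] and
    [d = p e], then [p (z - e) = c], so [z - e] could be adjoined to [C]. *)
Lemma divisible_summand D : subgroup D -> (forall d, D d -> exists2 e, D e & d = e *+ p) ->
  direct_summand D.
Proof.
move=> sD divD.
have [|C [sC _ CD maxC]] :=
  @maximal_subgroup _ (fun x => x = 0) (fun c => D c -> c = 0) (subgroup_zero G); first by [].
exists C; split=> //; split=> //; split=> [x Dx Cx|x]; first exact: CD.
change (sumg D C x); have sS := sumg_subgroup sD sC.
apply: contrapT => /(torsion_ladder_sub sS)[z [nSz [d [c [Dd [Cc zE]]]]]].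
have [e De dE] := divD d Dd.
have sE : (z - e) *+ p = c by rewrite mulrnBl zE dE addrC addKr.
have nSs : ~ sumg D C (z - e).
  by move=> Ss; apply: nSz; rewrite -(subrK e z); apply: subgroup_add => //; apply: sumgl.
apply: nSs; apply: sumgr => //; apply: maxC => c' a Cc' Dca.
have [/dvdzP[b aE]|pa] := boolP (p%:Z %| a)%Z.
  apply: CD => //; apply: subgroup_add => //.
  by rewrite aE mulrC mulrz_pM sE; apply: subgroup_mulz.
case: nSz; rewrite -(subrK e z); apply: subgroup_add => //; last exact: sumgl.
apply: (mulz_unit sS _ pa); first by rewrite sE; apply: sumgr.
rewrite -(addKr c' (_ *~ a)) addrC; exists (c' + (z - e) *~ a), (- c').
by split=> //; split=> //; apply: subgroup_opp.
Qed.

Lemma ex_last (P : nat -> Prop) m : P 0%N -> ~ P m ->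
  exists k, [/\ (k < m)%N, P k & ~ P k.+1].
Proof.
move=> P0; elim: m => // m IHm nP.
case: (pselect (P m)) => [Pm|/IHm[k [km Pk nPk]]]; first by exists m.
by exists k; split=> //; apply: ltnW.
Qed.

(* The complement [C] is maximal subject to [D] staying pure and disjoint modulo [C]. *)
Lemma pure_bounded_summand m D : subgroup D ->
  (forall k d, D d -> pow k d -> pmul D k d) -> (forall d, D d -> d *+ p ^ m = 0) ->
  exists C, int_direct_sum D C /\ (forall x, pow m x -> C x).
Proof.
move=> sD purD bndD.
(* On a subgroup [C] this says that [D] meets [p^j G + C] only in [p^j D]; for [j = m] and [g = 0]
   it gives disjointness from [C]. *)
pose Q c := forall j d g, D d -> d = g *+ p ^ j + c -> pmul D j d.
have [|C [sC mC CQ maxC]] := @maximal_subgroup _ (pow m) Q (pow_subgroup m).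
  move=> _ [c ->] j d g Dd dE; have [jm|mj] := leqP j m.
    apply: purD => //; rewrite dE; apply: subgroup_add (powX _ _) _; first exact: pow_subgroup.
    exact: pow_le jm (powX _ _).
  have [|e De ->] := purD m d Dd.
    rewrite dE; apply: subgroup_add (powX _ _); first exact: pow_subgroup.
    exact: pow_le (ltnW mj) (powX _ _).
  by rewrite bndD //; apply: (pmul_subgroup j sD).1.
have CD x : D x -> C x -> x = 0.
  move=> Dx /CQ /(_ m x 0 Dx); rewrite mul0rn add0r => /(_ erefl) [e De ->].
  exact: bndD.
exists C; split=> //; split=> //; split=> //; split=> // x.
change (sumg D C x); have sS := sumg_subgroup sD sC.
pose R j z := exists g c, C c /\ z = g *+ p ^ j + c.
have R_le j l z : (j <= l)%N -> R l z -> R j z.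
  move=> /subnK <- [g [c [Cc ->]]]; exists (g *+ p ^ (l - j)), c.
  by rewrite mulrnXX.
have Rpur j d : D d -> R j d -> pmul D j d.
  by move=> Dd [g [c [Cc dE]]]; apply: (CQ c Cc j d g).
apply: contrapT => /(torsion_ladder_sub sS)[z [nSz [d [c [Dd [Cc zE]]]]]].
(* Take a counterexample [s] of order [p] modulo [C] whose height [k] modulo [C] cannot be improved
   to [k + 1]. Writing [s = p^k y + c0], the aim is that [y] can be adjoined to [C]. *)
pose P k := exists s, [/\ C (s *+ p), ~ sumg D C s & R k s].
have [||k [km [s [Cs nSs [y [c0 [Cc0 sE]]]]] nPk]] := @ex_last P m.
- have [|e De dE] := Rpur 1%N d Dd.
    exists z, (- c); split; first exact: subgroup_opp.
    by rewrite expn1 zE addrK.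
  exists (z - e); split.
  + by rewrite mulrnBl zE dE expn1 addrC addKr.
  + by move=> Ss; apply: nSz; rewrite -(subrK e z); apply: subgroup_add => //; apply: sumgl.
  + by exists (z - e), 0; rewrite addr0; split=> //; apply: sC.1.
- move=> [s [_ nSs [g [c' [Cc' sE]]]]]; apply: nSs; rewrite sE; apply: sumgr => //.
  exact: subgroup_add sC (mC _ (powX _ _)) Cc'.
clear z nSz d c Dd Cc zE.
have Cy : C (y *+ p ^ k.+1).
  rewrite -mulrnX1; have -> : y *+ p ^ k = s - c0 by rewrite sE addrK.
  by rewrite mulrnBl; apply: sC.2 => //; apply: subgroup_muln.
have Cyl l : (k < l)%N -> C (y *+ p ^ l).
  by move=> /subnKC <-; rewrite -mulrnXX; apply: subgroup_muln.
apply: (nSs); rewrite sE; apply: sumgr => //; apply: subgroup_add => //.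
apply: subgroup_muln => //; apply: maxC => c a Cc j d g Dd dE.
case: (pselect ((p ^ j)%:Z %| a)%Z) => [/dvdzP[b aE]|npa].
  apply: Rpur => //; exists (g + y *~ b), c; split=> //.
  by rewrite dE aE mulrzA mulrnDl -pmulrn [c + _]addrC addrA.
have [|i [ij /dvdzP[u aE] npi]] := @ex_last (fun j => (p ^ j)%:Z %| a)%Z j _ npa.
  by rewrite expn0 dvd1z.
have pu : ~~ (p%:Z %| u)%Z.
  by apply/negP => pu; apply: npi; rewrite aE expnS PoszM dvdz_mul.
have yaE : y *~ a = y *+ p ^ i *~ u by rewrite aE mulrC mulrzA -pmulrn.
have [ki|ik] := ltnP k i.
  apply: Rpur => //; exists g, (c + y *~ a); split=> //; apply: subgroup_add => //.
  by rewrite yaE; apply: subgroup_mulz => //; apply: Cyl.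
(* Multiplying [d] by [p^(l+1)] pushes the [y]-term into [C], so [p^(l+1) d = p^(l+j+1) e] with [e]
   in [D]. Then [p^l d - p^(l+j) e - u s] is a counterexample of height at least [l + j > k] modulo
   [C]. *)
case: nPk; set l := (k - i)%N; have lk : (l + i = k)%N by rewrite subnK.
have [|e De eE] := Rpur (l + j).+1 (d *+ p ^ l.+1) (subgroup_muln _ sD Dd).
  exists g, (c *+ p ^ l.+1 + y *+ p ^ k.+1 *~ u); split.
    by apply: subgroup_add => //; [apply: subgroup_muln | apply: subgroup_mulz].
  rewrite dE yaE mulrnDl mulrnXX mulrnDl expn_mulz mulrnXX.
  by rewrite !addnS [(j + l)%N]addnC [(i + l)%N]addnC lk.
exists (d *+ p ^ l - e *+ p ^ (l + j) - s *~ u); split.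
- rewrite !mulrnBl !mulrnX1 eE subrr sub0r; apply: subgroup_opp => //.
  by rewrite -(expn1 p) expn_mulz expn1; apply: subgroup_mulz.
- move=> Ss; apply: (nSs).
  have Su : sumg D C (s *~ u).
    rewrite -(subKr (d *+ p ^ l - e *+ p ^ (l + j)) (s *~ u)); apply: sS.2 => //.
    by apply: sumgl => //; apply: sD.2; apply: subgroup_muln.
  by apply: (mulz_unit sS _ pu Su); apply: sumgr.
- apply: (@R_le _ (l + j)%N); first by rewrite -lk -addnS leq_add2l.
  exists (g - e), (c *+ p ^ l - c0 *~ u); split.
    by apply: sC.2; [apply: subgroup_muln | apply: subgroup_mulz].
  rewrite dE yaE sE mulrnDl mulrnXX mulrnDl expn_mulz mulrnXX mulrzDl mulrnBl.
  rewrite [(i + l)%N]addnC lk [(j + l)%N]addnC.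
  have E (a' b w e' c' : G) : a' + (b + w) - e' - (w + c') = a' - e' + (b - c').
    by rewrite opprD !addrA [_ + w - e']addrAC addrK [a' + b - e']addrAC.
  exact: E.
Qed.

(** * Sufficiency *)

Lemma socle_essential H D : subgroup D -> (forall x, D x -> x *+ p = 0 -> H x) -> essential H D.
Proof.
move=> sD DH S sS SD [s [Ss s0]].
have [i [ni pi]] := @torsion_ladder (fun x => x = 0) s erefl s0.
have Si : S (s *+ p ^ i) by apply: subgroup_muln.
by exists (s *+ p ^ i); split=> //; split=> //; apply: DH => //; apply: SD.
Qed.

Lemma finite_setS (A B : G -> Prop) : (forall x, A x -> B x) -> finite_set B -> finite_set A.
Proof. by move=> AB [s sB]; exists s => x /AB /sB. Qed.

Lemma finite_enum (A : G -> Prop) : finite_set A ->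
  exists s : seq G, uniq s /\ forall x, x \in s <-> A x.
Proof.
move=> [s As]; exists (undup [seq x <- s | `[< A x >]]); split; first exact: undup_uniq.
move=> x; rewrite mem_undup mem_filter; split=> [/andP[/asboolP]//|Ax].
by rewrite As // andbT; apply/asboolP.
Qed.

(** A chosen preimage of [x] in [D] under multiplication by [p^k], or 0 if there is none. *)
Definition quo D k x : G := xget 0 [set u : G | D u /\ u *+ p ^ k = x].

Lemma quoP D k u : D u -> D (quo D k (u *+ p ^ k)) /\ quo D k (u *+ p ^ k) *+ p ^ k = u *+ p ^ k.
Proof.
move=> Du; have := @xgetPex _ 0 [set v : G | D v /\ v *+ p ^ k = u *+ p ^ k].
by apply; exists u.
Qed.

(** Multiplication by [p] maps [D[p^(k+1)]] to [D[p^k]] with fibres that are cosets of [D[p]]. *)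
Lemma finite_torsion D k : subgroup D -> finite_set (fun x => D x /\ x *+ p = 0) ->
  finite_set (fun x => D x /\ x *+ p ^ k = 0).
Proof.
move=> sD [t fin1]; elim: k => [|k [s IHk]].
  by exists [:: 0] => x [_]; rewrite expn0 mulr1n => ->; rewrite mem_head.
exists [seq u + w | u <- [seq quo D 1 y | y <- s], w <- t] => x [Dx xk].
have [] := @quoP D 1 x Dx; rewrite expn1; set u := quo D 1 _ => Du uE.
rewrite -(addrNK u x) addrC; apply: allpairs_f.
  by apply: map_f; apply: IHk; rewrite mulrn1X; split=> //; apply: subgroup_muln.
by apply: fin1; split; [apply: sD.2 | rewrite mulrnBl uE subrr].
Qed.

(** Each of the finitely many socle elements either has infinite height or leaves [p^N G] for large
    [N]. *)
Lemma pow_stable k : finite_set (fun x => pow k x /\ x *+ p = 0) ->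
  exists2 N, (k <= N)%N & forall x, pow N x -> x *+ p = 0 -> forall j, pow j x.
Proof.
move=> [s fin].
suff [N kN NP] : exists2 N, (k <= N)%N & forall x, x \in s -> pow N x -> forall j, pow j x.
  by exists N => // x Nx px; apply: NP => //; apply: fin; split=> //; apply: pow_le Nx.
elim: s {fin} => [|x s [N kN IHs]]; first by exists k.
case: (pselect (forall j, pow j x)) => [px|/existsNP[j npx]].
  by exists N => // y; rewrite inE => /predU1P[->|/IHs].
exists (maxn N j) => [|y]; first by rewrite leq_max kN.
rewrite inE => /predU1P[->|ys] py; first by case: npx; apply: pow_le py; apply: leq_maxr.
by apply: IHs => //; apply: pow_le py; apply: leq_maxl.
Qed.

(** Induction on the exponent: [p^k x] is in the socle, hence equals [p^(N+k+1) w], and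
    [x - p^(N+1) w] is killed by [p^k]. *)
Lemma pow_divisible N : (forall x, pow N x -> x *+ p = 0 -> forall j, pow j x) ->
  forall x, pow N x -> exists2 y, pow N y & x = y *+ p.
Proof.
move=> stN x; have [k] := pG x; have sN := pow_subgroup N.
elim: k x => [|k IHk] x xk Nx.
  by exists 0; [apply: sN.1 | rewrite mul0rn -xk expn0 mulr1n].
have [] := stN (x *+ p ^ k) (subgroup_muln _ sN Nx) _ (N + k).+1; first by rewrite mulrnX1.
move=> w wE.
have Nw := powX N w.
have [||y Ny yE] := IHk (x - w *+ p ^ N *+ p).
- by rewrite mulrnBl wE mulrn1X mulrnXX addnS subrr.
- by apply: sN.2 => //; apply: subgroup_muln.
exists (y + w *+ p ^ N); first exact: subgroup_add.
by rewrite mulrnDl -yE subrK.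
Qed.

Lemma hom_to_quot0 H f : subgroup H -> hom_to_quot H f -> H (f 0).
Proof.
move=> sH hf; have := hf 0 0; rewrite addr0 opprD addrA subrr sub0r.
by move=> /(subgroup_opp sH); rewrite opprK.
Qed.

Lemma hom_to_quot_muln H f x n : subgroup H -> hom_to_quot H f -> H (f (x *+ n) - f x *+ n).
Proof.
move=> sH hf; elim: n => [|n IHn].
  by rewrite !mulr0n subr0; apply: hom_to_quot0 sH hf.
rewrite !mulrS -(subrKA (f x + f (x *+ n))); apply: subgroup_add => //.
by rewrite opprD addrACA subrr add0r.
Qed.

Lemma sgb_divisible : divisible G -> semi_generalized_bassian G.
Proof.
move=> divG H sH _.
have sT : subgroup (fun _ : G => True) by [].
have [//|D [[sD HD] _ DH neat _]] := @neat_hull (fun=> True) H H sT sH (fun _ _ => I).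
exists D; split=> //; split; last by split=> //; apply: socle_essential.
apply: divisible_summand => // d Dd.
have [y yd] := divG d p (prime_gt0 p_pr).
by have [|e De eE] := neat y I; [rewrite yd | exists e; rewrite // -eE].
Qed.

(* Counting: [(x, k) |-> f x + k] embeds [G[p^j] x (H :&: G[p^t])] in the preimage of
   [H :&: G[p^t]] under multiplication by [p^j], so that preimage is as large as possible. *)
Lemma finite_rank_kernel_height H f : finite_p_rank G p -> subgroup H ->
  hom_to_quot H f -> inj_to_quot H f -> forall h j, H h -> pow j h.
Proof.
move=> finG sH hf injf h j Hh; apply: contrapT => npow.
have fint k : finite_set (fun x : G => x *+ p ^ k = 0).
  have [s Ps] := @finite_torsion (fun=> True) k (conj I (fun _ _ _ _ => I))
    (finite_setS (fun x => @proj2 _ _) finG).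
  by exists s => x xk; apply: Ps.
have [X [uX XP]] := finite_enum (fint j).
(* A common exponent for [h] and the [f x] makes [p^j (f x + k)] fall in [G[p^t]]. *)
have [t tP] : exists t, forall u, u \in h :: [seq f x | x <- X] -> u *+ p ^ t = 0.
  elim: (h :: _) => [|u s [t tP]]; first by exists 0%N.
  have [k uk] := pG u; exists (t + k)%N => v; rewrite inE => /predU1P[->|/tP vt].
    by rewrite addnC -mulrnXX uk mul0rn.
  by rewrite -mulrnXX vt mul0rn.
have [K [uK KP]] := finite_enum (finite_setS (fun x => @proj2 (H x) _) (fint t)).
pose q := quo (fun=> True) j.
have qE b : q (b *+ p ^ j) *+ p ^ j = b *+ p ^ j by have [] := @quoP (fun=> True) j b I.
(* An element [b] is encoded by [p^j b] and its difference, in [G[p^j]], from the chosen preimage of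
   [p^j b]. As [h] is not in [p^j G], it never occurs as second component, which is one value too
   few for an injection. *)
pose F (xk : G * G) := let b := f xk.1 + xk.2 in (b - q (b *+ p ^ j), b *+ p ^ j).
pose XK := [seq (x, k) | x <- X, k <- K].
have uXK : uniq XK by apply: allpairs_uniq => // -[x k] [x' k'] _ _ [-> ->].
have hK : h \in K by apply/KP; split=> //; apply: tP; rewrite mem_head.
have FI : {in XK &, injective F}.
  move=> _ _ /allpairsP[[x k] /= [xX kK ->]] /allpairsP[[x' k'] /= [xX' kK' ->]].
  rewrite /F /= => -[E1 E2]; rewrite E2 in E1; move/addIr: E1 => E.
  have xx' : x = x'.
    apply: injf; rewrite -(addrK k (f x)) E -[_ + k' - k]addrA addrAC subrr add0r.
    by apply: sH.2; [case/KP: kK' | case/KP: kK].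
  by move: E; rewrite xx' => /addrI ->.
have sub : {subset map F XK <= [seq (x, k) | x <- X, k <- rem h K]}.
  move=> _ /mapP[_ /allpairsP[[x k] /= [xX kK ->]] ->]; rewrite /F /=.
  have [Hk kt] := (KP k).1 kK.
  apply: allpairs_f; first by apply/XP; rewrite mulrnBl qE subrr.
  rewrite mem_rem_uniq // inE; apply/andP; split.
    by apply/eqP => E; apply: npow; rewrite -E; apply: powX.
  apply/KP; split; last first.
    rewrite -mulrnA mulnC mulrnA mulrnDl kt addr0 tP ?mul0rn //.
    by rewrite inE map_f ?orbT.
  rewrite mulrnDl; apply: subgroup_add => //; last exact: subgroup_muln.
  have := hom_to_quot_muln x (p ^ j) sH hf; rewrite (XP x).1 // => Hx.
  rewrite -[X in H X](subKr (f 0)); apply: sH.2 => //; exact: hom_to_quot0 sH hf.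
have := uniq_leq_size _ sub; rewrite (map_inj_in_uniq FI) => /(_ uXK).
rewrite size_map !size_allpairs size_rem //.
have : (0 < size X)%N by rewrite -has_predT; apply/hasP; exists 0 => //; apply/XP; rewrite mul0rn.
have : (0 < size K)%N by rewrite -has_predT; apply/hasP; exists h.
by move=> K0 X0; rewrite leq_pmul2l // leqNgt ltn_predL K0.
Qed.

Lemma sgb_finite_rank : finite_p_rank G p -> semi_generalized_bassian G.
Proof.
move=> finG H sH [f [hf injf]].
have [N _ /pow_divisible divN] : exists2 N, (0 <= N)%N &
    forall x, pow N x -> x *+ p = 0 -> forall j, pow j x.
  by apply: pow_stable; apply: finite_setS finG => x [].
have HN x : H x -> pow N x by move=> Hx; apply: (finite_rank_kernel_height finG sH hf injf).
have [//|D [[sD HD] DN DH neat _]] := @neat_hull (pow N) H H (pow_subgroup N) sH HN.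
exists D; split=> //; split; last by split=> //; apply: socle_essential.
apply: divisible_summand => // d Dd; have [y Ny yE] := divN d (DN d Dd).
by have [|e De eE] := neat y Ny; [rewrite -yE | exists e; rewrite // -eE].
Qed.

(** [g] represents [f] modulo [H] by elements of [p^m G], hence is an injective self-map of a finite
    set, thus onto. If [h] in both [H] and [p^m G] is [g x], then [f x] is in [H], so [x = 0]; thus
    [g 0] is the only such [h]. *)
Lemma finite_pow_kernel H f m : finite_set (pow m) -> subgroup H ->
  hom_to_quot H f -> inj_to_quot H f -> forall h, H h -> pow m h -> h = 0.
Proof.
move=> /finite_enum[X [uX XP]] sH hf injf.
have powf x : pow m x -> exists y, pow m y /\ H (f x - y).
  move=> [u ->]; exists (f u *+ p ^ m); split; first exact: powX.
  exact: hom_to_quot_muln u _ sH hf.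
pose g x := xget 0 [set y | pow m y /\ H (f x - y)].
have gP x : pow m x -> pow m (g x) /\ H (f x - g x).
  by move=> /powf px; apply: (@xgetPex _ 0 [set y | pow m y /\ H (f x - y)]).
have gI : {in X &, injective g}.
  move=> x y /XP /gP[_ Hx] /XP /gP[_ Hy] gxy; apply: injf.
  rewrite -(subrKA (g x)); apply: subgroup_add => //.
  by rewrite gxy -opprB; apply: subgroup_opp.
have gX : {subset map g X <= X} by move=> _ /mapP[x /XP /gP[px _] ->]; apply/XP.
have surj : map g X =i X.
  by have [||_ //] := uniq_min_size _ gX; rewrite ?map_inj_in_uniq ?size_map.
have g0 h : H h -> pow m h -> h = g 0.
  move=> Hh /XP; rewrite -surj => /mapP[x /XP /gP[_ Hx] hE]; rewrite hE.
  congr (g _); apply: injf; apply: sH.2; last exact: hom_to_quot0 sH hf.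
  by rewrite -(subrK (g x) (f x)); apply: subgroup_add => //; rewrite -hE.
by move=> h Hh mh; rewrite (g0 h) // -(g0 0) //; [apply: sH.1 | apply: (pow_subgroup m).1].
Qed.

Lemma neat_summand n D : (forall x, x *+ p = 0 -> pow n.-1 x) -> subgroup D ->
  (forall y, D (y *+ p) -> exists2 d, D d & y *+ p = d *+ p) ->
  (forall x, D x -> pow n.+1 x -> x = 0) ->
  exists C, int_direct_sum D C /\ (forall x, pow n.+1 x -> C x).
Proof.
move=> socn sD neat Dn; apply: pure_bounded_summand => //; first exact: neat_pure socn sD neat Dn.
by move=> d Dd; apply: Dn; [apply: subgroup_muln | apply: powX].
Qed.

(** The two hypotheses are what case (3) contributes to sufficiency. *)
Lemma sgb_bounded n : (forall x : G, x *+ p = 0 -> pow n.-1 x) -> finite_set (pow n.+1) ->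
  semi_generalized_bassian G.
Proof.
move=> socn finn H sH [f [hf injf]].
have sT : subgroup (fun _ : G => True) by [].
have [//|D [[sD HD] _ DH neat _]] := @neat_hull (fun=> True) H H sT sH (fun _ _ => I).
have essD : essential H D by apply: socle_essential.
exists D; split=> //; split=> //.
have [| |C [DC _]] := @neat_summand n D socn sD; last by exists C.
  by move=> y; apply: neat.
move=> x Dx px; apply: contrapT => x0.
have [i [ni pi]] := @torsion_ladder (fun x => x = 0) x erefl x0.
apply: ni; apply: (finite_pow_kernel finn sH hf injf).
  2: exact: subgroup_muln (pow_subgroup _) px.
by apply: DH => //; apply: subgroup_muln.
Qed.

(** * Additive maps from an external direct sum of cyclic groups *)

Section DirectSum.
Variables (K : Type) (m : K -> nat) (Phi : (K -> nat) -> G).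
Hypothesis m_gt0 : forall k, (0 < m k)%N.
Hypothesis PhiD : forall c d, dsum_elem m c -> dsum_elem m d ->
  Phi (dsum_add m c d) = Phi c + Phi d.

Lemma dsum_elem_supp c d : dsum_elem m c -> (forall k, d k < m k)%N ->
  (forall k, c k = 0 -> d k = 0)%N -> dsum_elem m d.
Proof.
by move=> [_ [s cs]] dm cd; split=> //; exists s => k dk; apply: cs => /cd.
Qed.

Lemma dsum_elem0 : dsum_elem m (fun=> 0%N).
Proof. by split=> //; exists nil => k. Qed.

Lemma dsum_morph0 : Phi (fun=> 0%N) = 0.
Proof.
have := PhiD dsum_elem0 dsum_elem0.
rewrite (_ : dsum_add _ _ _ = fun=> 0%N); last by apply/funext => k; rewrite /dsum_add mod0n.
by move=> /eqP; rewrite -subr_eq subrr => /eqP.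
Qed.

Lemma dsum_morph_muln c e : dsum_elem m c ->
  dsum_elem m (fun k => (e * c k) %% m k)%N /\ Phi c *+ e = Phi (fun k => (e * c k) %% m k)%N.
Proof.
move=> mc; have me e' : dsum_elem m (fun k => (e' * c k) %% m k)%N.
  by apply: (dsum_elem_supp mc) => k; [rewrite ltn_mod | move=> ->; rewrite muln0 mod0n].
split=> //; elim: e => [|e IHe].
  rewrite mulr0n -dsum_morph0; congr Phi; apply/funext => k; by rewrite mul0n mod0n.
rewrite mulrS IHe -PhiD //; congr Phi; apply/funext => k.
by rewrite /dsum_add modnDmr mulSn.
Qed.

End DirectSum.

Lemma two_orders_dsum A n (I J : Type) : (0 < n)%N -> iso_to_dsum A (@two_orders p n I J) ->
  (forall x, A x -> x *+ p ^ n.+1 = 0) /\ (forall x, A x -> x *+ p = 0 -> pow n.-1 x).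
Proof.
move=> n0 [Phi [PhiA [PhiD [PhiI PhiS]]]]; set m := @two_orders p n I J in PhiA PhiD PhiI PhiS.
have p0 : (0 < p)%N by rewrite prime_gt0.
have m0 k : (0 < m k)%N by case: k => k; rewrite expn_gt0 p0.
have mn k : (m k %| p ^ n.+1)%N by case: k => k; rewrite dvdn_Pexp2l ?prime_gt1.
have nm k : (p ^ n %| m k)%N by case: k => k; rewrite dvdn_Pexp2l ?prime_gt1.
split=> x /PhiS[c [mc <-]].
  rewrite (dsum_morph_muln m0 PhiD _ mc).2 -(dsum_morph0 m0 PhiD); congr Phi.
  by apply/funext => k; apply/eqP; apply: dvdn_mulr.
have [mpc ->] := dsum_morph_muln m0 PhiD p mc; rewrite -(dsum_morph0 m0 PhiD).
move=> /(PhiI _ _ mpc (dsum_elem0 m0)) E.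
(* [p^n] divides [m k], which divides [p * c k]. *)
have dc k : (p ^ n.-1 %| c k)%N.
  have /eqP mk : ((p * c k) %% m k = 0)%N by have := congr1 (@^~ k) E.
  rewrite -(@dvdn_pmul2l p) // -expnS prednK //; exact: dvdn_trans (nm k) mk.
pose d k := (c k %/ p ^ n.-1)%N.
have md : dsum_elem m d.
  apply: (dsum_elem_supp mc) => k; last by rewrite /d => ->; rewrite div0n.
  by apply: leq_ltn_trans (leq_div _ _) _; apply: mc.1.
exists (Phi d); rewrite (dsum_morph_muln m0 PhiD _ md).2; congr Phi; apply/funext => k.
by rewrite mulnC divnK // modn_small //; apply: mc.1.
Qed.

Lemma sgb_condition3 : condition3 G p -> semi_generalized_bassian G.
Proof.
move=> [n [n0 [G' [F [I [J [[sG' [sF [dis gen]]] [isoG' [finF socF]]]]]]]]].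
have [expG' socG'] := two_orders_dsum n0 isoG'.
apply: (@sgb_bounded n).
  move=> x px; have [a [b [Ga [Fb xE]]]] := gen x.
  have pab : a *+ p = - (b *+ p) by apply/eqP; rewrite -addr_eq0 -mulrnDl -xE px.
  have pa : a *+ p = 0.
    apply: dis; first exact: subgroup_muln.
    by rewrite pab; apply: subgroup_opp sF (subgroup_muln _ sF Fb).
  have pb : b *+ p = 0 by apply/eqP; rewrite -oppr_eq0 -pab pa.
  rewrite xE; apply: subgroup_add (pow_subgroup _) (socG' _ Ga pa) _.
  have [u ->] := socF b Fb pb; apply: pow_le (powX n.+1 u); lia.
apply: finite_setS finF => _ [x ->]; have [a [b [Ga [Fb ->]]]] := gen x.
by rewrite mulrnDl expG' // add0r; apply: subgroup_muln.
Qed.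

(** * Subgroups that are not essential in a summand *)

Lemma summand_pure D k u : direct_summand D -> D (u *+ p ^ k) ->
  exists2 d, D d & u *+ p ^ k = d *+ p ^ k.
Proof.
move=> [C [sD [sC [DC gen]]]] Du; have [d [c [Dd [Cc uE]]]] := gen u.
exists d => //; rewrite uE mulrnDl (DC (c *+ p ^ k)) ?addr0 //; last exact: subgroup_muln.
rewrite -(addKr (d *+ p ^ k) (c *+ _)) -mulrnDl -uE addrC.
by apply: sD.2 => //; apply: subgroup_muln.
Qed.

(* Purity of a summand [D] containing [x + p y] produces an element of [D[p]] of height
   [a - 1], whereas [H[p]] has none. *)
Lemma no_essential_summand H D a x y : subgroup H -> direct_summand D ->
  (forall z, H z -> D z) -> essential H D ->
  (0 < a)%N -> x *+ p ^ a = 0 -> ~ pow a (x *+ p ^ a.-1) -> H (x + y *+ p) ->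
  (forall h, H h -> h *+ p = 0 -> pow a h) -> False.
Proof.
move=> sH sumD HD essD a0 xa xa1 Hxy Ha.
have sD : subgroup D by case: sumD => C [].
have [|c Dc cE] := @summand_pure D a.+1 y sumD.
  rewrite -mulrn1X -[_ *+ p ^ a]add0r -xa -mulrnDl; apply: subgroup_muln => //.
  exact: HD.
(* Since [p^(a+1) c = p^(a+1) y], this [t] is killed by [p], and it is congruent to [p^(a-1) x]
   modulo [p^a G]. *)
pose t := (x + y *+ p - c *+ p) *+ p ^ a.-1.
have tE : t = x *+ p ^ a.-1 + (y - c) *+ p ^ a.
  rewrite /t -addrA -mulrnBl mulrnDl mulrn1X prednK //.
have Dt : D t.
  by apply: subgroup_muln => //; apply: sD.2; [apply: HD | apply: subgroup_muln].
have pt : t *+ p = 0.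
  by rewrite tE mulrnDl mulrnX1 prednK // xa add0r mulrnX1 mulrnBl cE subrr.
have npt : ~ pow a t.
  move=> at_; apply: xa1; rewrite -(addrK ((y - c) *+ p ^ a) (x *+ _)) -tE.
  by apply: (pow_subgroup a).2 => //; apply: powX.
apply: npt; apply: Ha => //.
have [||s [[d [b [d0 sE]]] [Hs s0]]] :=
    essD (adjoin (fun z => z = 0) t) (adjoin_subgroup t (subgroup_zero G)).
- by move=> _ [d [b [-> ->]]]; rewrite add0r; apply: subgroup_mulz.
- exists t; split; first by exists 0, 1; rewrite add0r.
  move=> t0; apply: xa1; move: tE => /esym/eqP; rewrite t0 addr_eq0 -mulNrn => /eqP->.
  exact: powX.
rewrite d0 add0r in sE; rewrite sE in Hs s0.
have [/dvdzP[e bE]|pb] := boolP (p%:Z %| b)%Z.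
  by case: s0; rewrite bE mulrC mulrz_pM pt mul0rz.
by apply: (mulz_unit sH _ pb Hs); rewrite pt; apply: sH.1.
Qed.

Lemma pair_mulz (x y : G) (a : int) : (x, y) *~ a = (x *~ a, y *~ a).
Proof.
have n k : (x, y) *+ k = (x *+ k, y *+ k).
  by elim: k => [|k IHk]; rewrite ?mulr0n // !mulrS IHk.
by case: a => k; rewrite ?NegzE ?mulrNz -!pmulrn n.
Qed.

(* The embedding is obtained as a maximal graph among the partial homomorphisms [G -> G/H]
   that are the identity modulo [M]; divisibility of [M/H] makes a maximal one total. *)
Lemma embed_quotient H M (T : G * G -> Prop) : subgroup H -> subgroup M ->
  (forall x, H x -> M x) -> (forall m, M m -> exists2 m', M m' & H (m' *+ p - m)) ->
  subgroup T -> (forall x y, T (x, y) -> M x /\ M y) -> (forall y, T (0, y) -> H y) ->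
  (forall x y, T (x, y) -> H y -> x = 0) -> (forall x, M x -> x *+ p = 0 -> exists y, T (x, y)) ->
  exists f : G -> G, hom_to_quot H f /\ inj_to_quot H f.
Proof.
move=> sH sM HM divM sT TM T0 TI Ttot.
(* The second condition makes a subgroup of pairs single-valued modulo [H]. *)
pose Q (z : G * G) := M (z.1 - z.2) /\ (z.1 = 0 -> H z.2).
have [|E [sE TE EQ maxE]] := @maximal_subgroup _ T Q sT.
  by move=> [x y] Txy; split=> /= [|x0]; [have [Mx My] := TM x y Txy; apply: sM.2
    | apply: T0; rewrite -x0].
pose dom x := exists y, E (x, y).
have sdom : subgroup dom.
  split; first by exists 0; apply: sE.1.
  by move=> x y [x' Ex] [y' Ey]; exists (x' - y'); apply: (sE.2 _ _ Ex Ey).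
have tot u : dom u.
  apply: contrapT => /(torsion_ladder_sub sdom)[{}u [ndu [v Ev]]].
  have [Muv _] := EQ _ Ev; have [m Mm Hm] := divM _ Muv; rewrite /= in Hm.
  (* Modulo [H], [p m = p u - v], that is, [p (u - m) = v]; so the pair [(u, u - m)] is compatible
     with [(p u, v)]. *)
  apply: (ndu); exists (u - m); apply: maxE => -[x y] a Exy; rewrite pair_mulz.
  have [Mxy _] := EQ _ Exy.
  split=> /= [|xu].
    by rewrite mulrzBl opprD addrACA subKr; apply: subgroup_add => //; apply: subgroup_mulz.
  have [/dvdzP[b aE]|pa] := boolP (p%:Z %| a)%Z; last first.
    case: ndu; apply: (mulz_unit sdom _ pa); first by exists v.
    have -> : u *~ a = - x by apply/eqP; rewrite -addr_eq0 addrC xu.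
    by exists (- y); apply: (subgroup_opp sE Exy).
  have Eb := subgroup_mulz b sE Ev; rewrite pair_mulz in Eb.
  have [_ /= Hyv] := EQ _ (subgroup_add sE Exy Eb).
  have {}Hyv : H (y + v *~ b) by apply: Hyv; rewrite -xu aE mulrC mulrz_pM.
  rewrite aE mulrC mulrz_pM -(subrK v ((u - m) *+ p)) mulrzDl addrC -addrA [_ + y]addrC.
  apply: subgroup_add => //; apply: subgroup_mulz => //.
  by rewrite mulrnBl addrAC -opprB; apply: subgroup_opp.
have [f fP] := choice tot; exists f; split=> [x y|x y Hxy].
  have := sE.2 _ _ (fP (x + y)) (subgroup_add sE (fP x) (fP y)).
  by move=> /EQ[_]; apply; rewrite /= subrr.
have Exy := sE.2 _ _ (fP x) (fP y).
(* The kernel lies in [M]; a non-zero kernel element would have a non-zero multiple in [M[p]], where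
   the map is given by the injective [T]. *)
have Mxy : M (x - y).
  have [/= Mz _] := EQ _ Exy; rewrite -(subrK (f x - f y) (x - y)).
  by apply: subgroup_add => //; apply: HM.
apply/eqP; rewrite -subr_eq0; apply/eqP; apply: contrapT => xy0.
have [i [ni pi]] := @torsion_ladder (fun x => x = 0) (x - y) erefl xy0.
have [w Tw] := Ttot _ (subgroup_muln (p ^ i) sM Mxy) pi.
apply: ni; apply: (TI _ w Tw).
have Ei := subgroup_mulz (p ^ i)%:Z sE Exy; rewrite pair_mulz -!pmulrn in Ei.
have [_ /=] := EQ _ (sE.2 _ _ Ei (TE _ Tw)); rewrite subrr => /(_ erefl) Hw.
rewrite -(subKr ((f x - f y) *+ p ^ i) w); apply: sH.2 => //; exact: subgroup_muln.
Qed.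

Lemma finite_adjoin D x : subgroup D -> finite_set D -> x *+ p = 0 -> finite_set (adjoin D x).
Proof.
move=> sD [s sDs] px; exists [seq d + x *+ k | d <- s, k <- iota 0 p] => _ [d [a [Dd ->]]].
have p0 : p%:Z != 0 by rewrite eqz_nat -lt0n prime_gt0.
rewrite (divz_eq a p%:Z) mulrzDr [_ * p%:Z]mulrC mulrz_pM px mul0rz add0r.
have := modz_ge0 a p0; have := @ltz_pmod a p%:Z.
case: (a %% p)%Z => // k kp _; rewrite -pmulrn; apply: allpairs_f; first exact: sDs.
by rewrite mem_iota /= add0n; apply: kp; rewrite ltz_nat prime_gt0.
Qed.

Implicit Types q : {poly int}.

Lemma ev_muln (y : nat -> G) q n : ev y q *+ n = ev (fun i => y i *+ n) q.
Proof.
rewrite /ev -sumrMnl; apply: eq_bigr => i _.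
by rewrite !pmulrn -!mulrzA mulrC.
Qed.

Fixpoint chain D (S : nat -> G -> Prop) i : G -> Prop :=
  if i is j.+1 then adjoin (chain D S j) (xget 0 [set s | S j s /\ ~ chain D S j s]) else D.

(** [D] enlarged by finitely many elements killed by [p] stays finite, so the infinite [S i]
    supplies an element outside. In a relation, a last coefficient prime to [p] would put its
    element in the previous stage. *)
Lemma independent_sequence D (S : nat -> G -> Prop) : subgroup D -> finite_set D ->
  (forall i x, S i x -> x *+ p = 0) -> (forall i, ~ finite_set (S i)) ->
  exists s : nat -> G, (forall i, S i (s i)) /\
    (forall q, D (ev s q) -> forall i, (p%:Z %| q`_i)%Z).
Proof.
move=> sD fD Sp Sinf.
pose s i := xget 0 [set s | S i s /\ ~ chain D S i s].
have sP i : [/\ subgroup (chain D S i), finite_set (chain D S i), S i (s i) & ~ chain D S i (s i)].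
  have pick j : finite_set (chain D S j) -> S j (s j) /\ ~ chain D S j (s j).
    move=> fj; apply: (@xgetPex _ 0 [set s | S j s /\ ~ chain D S j s]).
    apply: contrapT => nex; apply: (Sinf j); apply: finite_setS fj => x Sx.
    by apply: contrapT => nx; apply: nex; exists x.
  suff [] : subgroup (chain D S i) /\ finite_set (chain D S i).
    by move=> si fi; have [] := pick i fi; split.
  elim: i => //= i [si fi]; split; first exact: adjoin_subgroup.
  by apply: finite_adjoin => //; have [Si _] := pick i fi; apply: Sp Si.
exists s; split=> [i|q]; first by case: (sP i).
have sub i (c : nat -> int) : chain D S i (\sum_(j < i) s j *~ c j).
  elim: i => [|i IHi]; first by rewrite big_ord0; apply: sD.1.
  by rewrite big_ord_recr /=; exists (\sum_(j < i) s j *~ c j), (c i).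
suff ind n (c : nat -> int) : D (\sum_(i < n) s i *~ c i) -> forall i, (i < n)%N -> (p%:Z %| c i)%Z.
  move=> Dq i; case: (ltnP i (size q)) => [iq|iq]; last by rewrite nth_default.
  exact: (ind _ (fun i => q`_i) Dq).
have DS i x : D x -> chain D S i x.
  by elim: i => //= i IHi /IHi Dx; exists x, 0; rewrite mulr0z addr0.
elim: n => // n IHn; rewrite big_ord_recr /= => Dn.
have [sn _ Sn nSn] := sP n.
have pn : (p%:Z %| c n)%Z.
  apply/negPn/negP => npn; apply: nSn; apply: (mulz_unit sn _ npn).
    by rewrite (Sp _ _ Sn); apply: sn.1.
  rewrite -(addKr (\sum_(i < n) s i *~ c i) (_ *~ _)) addrC.
  by apply: sn.2; [apply: DS | apply: sub].
move=> i; rewrite ltnS leq_eqVlt => /predU1P[->//|]; apply: IHn.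
by case/dvdzP: pn Dn => b ->; rewrite mulrC mulrz_pM (Sp _ _ Sn) mul0rz addr0.
Qed.

Lemma dvdz_quo (d a : int) : (d %| a)%Z -> a = d * (a %/ d)%Z.
Proof. by move=> da; rewrite mulrC divzK. Qed.

(** * Independence deduced from the socle *)

Section Independent.
Variables (Y : nat -> G) (b : nat -> nat).
Hypothesis b_gt0 : forall i, (0 < b i)%N.
Hypothesis Yb : forall i, Y i *+ p ^ b i = 0.
Hypothesis indY : forall q, ev (fun i => Y i *+ p ^ (b i).-1) q = 0 -> forall i, (p%:Z %| q`_i)%Z.

Lemma independent_neq0 i : Y i *+ p ^ (b i).-1 <> 0.
Proof.
move=> Y0; have := @indY 'X^i; rewrite evXn => /(_ Y0 i); rewrite coefXn eqxx.
by rewrite dvdzE /= dvdn1 => /eqP p1; have := p_pr; rewrite p1.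
Qed.

Lemma independent_order i (a : int) : Y i *~ a = 0 -> ((p ^ b i)%:Z %| a)%Z.
Proof. exact: order_dvd (Yb i) (b_gt0 i) (@independent_neq0 i). Qed.

Lemma expn_pred i : (p ^ b i)%:Z = (p ^ (b i).-1)%:Z * p%:Z.
Proof. by rewrite -PoszM -expnSr prednK. Qed.

Lemma p_neq0 : p%:Z != 0.
Proof. by rewrite eqz_nat -lt0n prime_gt0. Qed.

Lemma independent_socle r q :
  (forall i, Y i *~ q`_i *+ p ^ r *+ p = 0) ->
  forall i, ((p ^ (b i).-1)%:Z %| q`_i * (p ^ r)%:Z)%Z.
Proof.
move=> Yq i; have : ((p ^ b i)%:Z %| q`_i * (p ^ r)%:Z * p%:Z)%Z.
  by apply: independent_order; rewrite !mulrzA -!pmulrn.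
by rewrite expn_pred dvdz_mul2r ?p_neq0.
Qed.

(** Induction on an exponent [p^r] killing all terms [q_i Y_i]. For [r + 1], the [p^r q_i Y_i] are
    multiples [d_i] of the independent socle elements with sum 0, so [p] divides every [d_i] and
    [p^r] already kills all terms. *)
Lemma independent_ev q : ev Y q = 0 -> forall i, ((p ^ b i)%:Z %| q`_i)%Z.
Proof.
move=> Yq.
suff: forall r, (forall i, Y i *~ q`_i *+ p ^ r = 0) -> forall i, ((p ^ b i)%:Z %| q`_i)%Z.
  move=> /(_ (\sum_(i < size q) b i)%N); apply=> i.
  case: (ltnP i (size q)) => [iq|iq]; last by rewrite nth_default // mulr0z mul0rn.
  rewrite expn_mulz (bigD1 (Ordinal iq)) //=.
  by rewrite -mulrnXX Yb mul0rn mul0rz.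
elim=> [|r IHr] Yr; first by move=> i; apply: independent_order; rewrite -(Yr i) expn0.
have dv := @independent_socle r q _.
have {}dv i : ((p ^ (b i).-1)%:Z %| q`_i * (p ^ r)%:Z)%Z.
  by apply: dv => j; rewrite mulrnX1.
pose d := \poly_(i < size q) (q`_i * (p ^ r)%:Z %/ (p ^ (b i).-1)%:Z)%Z.
have dE i : Y i *+ p ^ (b i).-1 *~ d`_i = Y i *+ p ^ r *~ q`_i.
  rewrite coef_poly; case: ltnP => iq; last by rewrite nth_default // !mulr0z.
  by rewrite pmulrn -mulrzA -dvdz_quo // mulrC mulrzA -pmulrn.
have pd : forall i, (p%:Z %| d`_i)%Z.
  by apply: indY; rewrite (ev_eq dE) -ev_muln Yq mul0rn.
apply: IHr => i; rewrite expn_mulz -dE (dvdz_quo (pd i)) mulrz_pM.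
by rewrite mulrnX1 prednK // Yb mul0rz.
Qed.

Lemma independent_ev_socle q : ev Y q *+ p = 0 -> forall i, ((p ^ (b i).-1)%:Z %| q`_i)%Z.
Proof.
rewrite -evMn => /independent_ev pq i; have := pq i.
by rewrite coefMn -mulr_natr natz expn_pred dvdz_mul2r ?p_neq0.
Qed.

End Independent.

(** * Infinite socles of all heights *)

Lemma ev_recl (V : zmodType) (y : nat -> V) q :
  ev y q = y 0%N *~ q`_0 + ev (fun i => y i.+1) (drop_poly 1 q).
Proof.
rewrite (@ev_widen _ _ q (size q).+1) // big_ord_recl; congr (_ + _).
rewrite (@ev_widen _ _ _ (size q)); last by rewrite size_drop_poly leq_subr.
by apply: eq_bigr => i _; rewrite coef_drop_poly addn1.
Qed.

Definition int_poly (v : {poly rat}) : Prop := forall l, exists n : int, v`_l = n%:~R.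

Lemma int_poly_subgroup : subgroup int_poly.
Proof.
split=> [l|u v Zu Zv l]; first by exists 0; rewrite coef0.
have [m um] := Zu l; have [n vn] := Zv l.
by exists (m - n); rewrite coefB um vn rmorphB.
Qed.

(* The elements [prufer_gen j k] modulo [int_poly] generate the direct sum over [j] of the
   quasicyclic groups [Z(p^oo)]. *)
Definition prufer_gen j k : {poly rat} := ((p ^ k.+1)%:R)^-1 *: 'X^j.

Lemma prufer_gen_coef j k (c : int) l :
  (prufer_gen j k *~ c)`_l = (l == j)%:R * (c%:~R / (p ^ k.+1)%:R).
Proof.
by rewrite coefMrz coefZ coefXn -mulrzl [LHS]mulrA mulrC.
Qed.

Lemma p_natr_neq0 k : (p ^ k)%:R != 0 :> rat.
Proof. by rewrite Num.Theory.pnatr_eq0 -lt0n expn_gt0 prime_gt0. Qed.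

Lemma prufer_gen_int j k (c : int) : ((p ^ k.+1)%:Z %| c)%Z -> int_poly (prufer_gen j k *~ c).
Proof.
move=> /dvdzP[d ->] l; rewrite prufer_gen_coef intrM -[(Posz _)%:~R]/((p ^ k.+1)%:R).
rewrite mulfK ?p_natr_neq0 //; case: (l == j); [exists d | exists 0]; by rewrite ?mul1r ?mul0r.
Qed.

Lemma int_prufer_gen k (c n : int) : c%:~R / (p ^ k.+1)%:R = n%:~R :> rat ->
  ((p ^ k.+1)%:Z %| c)%Z.
Proof.
move=> /(canRL (mulfVK (p_natr_neq0 _))) E; apply/dvdzP; exists n.
by apply: (@intr_inj rat); rewrite E intrM.
Qed.

Lemma prufer_gen_p j k : prufer_gen j k.+1 *+ p = prufer_gen j k.
Proof.
rewrite /prufer_gen scalerMnl; congr (_ *: _).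
by rewrite -mulr_natr expnS natrM invfM mulrAC mulVf ?mul1r // -(expn1 p) p_natr_neq0.
Qed.

Lemma not_sgb_unbounded a x : (0 < a)%N -> x *+ p ^ a = 0 -> ~ pow a (x *+ p ^ a.-1) ->
  (forall k, ~ finite_set (fun z : G => pow k z /\ z *+ p = 0)) -> ~ semi_generalized_bassian G.
Proof.
move=> a0 xa xa1 inf sgb.
pose x1 := x *+ p ^ a.-1.
have px1 : x1 *+ p = 0 by rewrite mulrnX1 prednK.
have x1n0 : x1 <> 0 by move=> E; apply: xa1; rewrite -/x1 E; apply: (pow_subgroup a).1.
pose T1 := adjoin (fun z : G => z = 0) x1.
have sT1 : subgroup T1 by apply: adjoin_subgroup; apply: subgroup_zero.
have fT1 : finite_set T1.
  by apply: finite_adjoin => //; [apply: subgroup_zero | exists [:: 0] => z ->; rewrite mem_head].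
pose jk0 i : nat * nat := odflt (0, 0)%N (unpickle i).
(* With [(j, k) = jk0 i], a generator of order [p^(a+k+2)] will be sent to [1/p^(k+1)] on coordinate
   [j]. Its socle then has height at least [a] and is sent to 0. Indices that code no pair default
   to [(0, 0)]. *)
pose h i := (a + (jk0 i).2.+1)%N.
have [|i|s [sS sI]] := @independent_sequence T1 (fun i z => pow (h i) z /\ z *+ p = 0) sT1 fT1.
- by move=> i z [].
- exact: inf.
have /choice[y yE] : forall i, exists y, s i = y *+ p ^ h i by move=> i; case: (sS i).
have ps i : s i *+ p = 0 by case: (sS i).
(* Index 0 is reserved for [x], which is sent to [1/p^a] on coordinate 0. *)
pose Y i := if i is i'.+1 then y i' else x.
pose b i := if i is i'.+1 then (h i').+1 else a.
pose jk i : nat * nat := if i is i'.+1 then jk0 i' else (0, a.-1)%N.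
pose w i := prufer_gen (jk i).1 (jk i).2.
have b0 i : (0 < b i)%N by case: i.
have kb i : ((jk i).2 < b i)%N by case: i => [|i] /=; rewrite ?prednK // /h; lia.
have Yb i : Y i *+ p ^ b i = 0 by case: i => //= i; rewrite -mulrnX1 -yE.
pose s1 i := Y i *+ p ^ (b i).-1.
have s1S q : ev (fun i => s1 i.+1) q = ev s q by apply: ev_eq => i; rewrite /s1 /= yE.
have indY q : ev s1 q = 0 -> forall i, (p%:Z %| q`_i)%Z.
  rewrite ev_recl s1S /s1 /= -/x1 => E.
  have pS : forall i, (p%:Z %| (drop_poly 1 q)`_i)%Z.
    apply: sI; exists 0, (- q`_0); split=> //; rewrite add0r mulrNz.
    by apply/eqP; rewrite -addr_eq0 addrC E.
  case=> [|i]; last by have := pS i; rewrite coef_drop_poly addn1.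
  apply/negPn/negP => pq; apply: x1n0.
  apply: (mulz_unit (subgroup_zero G) px1 pq); rewrite -{}E.
  rewrite [ev s _](_ : _ = 0) ?addr0 //; apply: (ev_subgroup (subgroup_zero G)) => i.
  by rewrite (dvdz_quo (pS i)) mulrz_pM ps mul0rz.
have sZ := int_poly_subgroup.
pose M z := exists q, z = ev Y q.
have sM : subgroup M.
  split; first by exists 0; rewrite ev0.
  by move=> _ _ [q ->] [r ->]; exists (q - r); rewrite ev_sub.
(* The kernel of the homomorphism from [M] to the sum of quasicyclic groups with [Y i] sent to
   [w i]; by [HZ] the choice of [q] is immaterial. *)
pose H z := exists q, z = ev Y q /\ int_poly (ev w q).
have sH : subgroup H.
  split; first by exists 0; rewrite !ev0; split=> //; apply: sZ.1.
  by move=> _ _ [q [-> Zq]] [r [-> Zr]]; exists (q - r); rewrite !ev_sub; split=> //; apply: sZ.2.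
have HZ q : H (ev Y q) -> int_poly (ev w q).
  move=> [r [/eqP qr Zr]]; rewrite -(subrK (ev w r) (ev w q)) -ev_sub.
  apply: (subgroup_add sZ) => //.
  apply: (ev_subgroup sZ) => // i; apply: prufer_gen_int.
  have /(independent_ev b0 Yb indY) /(_ i) : ev Y (q - r) = 0.
    by apply/eqP; rewrite ev_sub subr_eq0.
  by apply: dvdz_trans; rewrite dvdzE /= dvdn_exp2l.
(* [sg] realizes division by [p] in [M/H]. *)
pose sg i := (pickle ((jk i).1, (jk i).2.+1)).+1.
have wsg i : w (sg i) *+ p = w i.
  by rewrite /w /sg /= /jk0 pickleK /= prufer_gen_p.
pose ta (i : nat) := (pickle (i, 0%N)).+1.
have wta i : w (ta i) = prufer_gen i 0 by rewrite /w /ta /= /jk0 pickleK.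
(* The basis element [s1 i] of [M[p]] goes to an element with image [1/p] on coordinate [i], which
   embeds [M[p]] in [M/H]. *)
pose T (z : G * G) := exists c, z = (ev s1 c, ev (fun i => Y (ta i)) c).
have TZ c : H (ev (fun i => Y (ta i)) c) <-> int_poly (ev (fun i => w (ta i)) c).
  by rewrite -!ev_reindex; split=> [/HZ|Z] //; exists (reindex ta c).
have s10 (c : {poly int}) : (forall i, (p%:Z %| c`_i)%Z) -> ev s1 c = 0.
  move=> pc; apply: (ev_subgroup (subgroup_zero G)) => i.
  by rewrite (dvdz_quo (pc i)) mulrz_pM /s1 mulrnX1 prednK // Yb mul0rz.
have emb : exists f : G -> G, hom_to_quot H f /\ inj_to_quot H f.
  apply: (@embed_quotient H M T) => //.
  - by move=> z [q [-> _]]; exists q.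
  - move=> _ [q ->]; pose q' := reindex sg q.
    exists (ev Y q'); first by exists q'.
    exists (q' *+ p - q); rewrite ev_sub evMn; split=> //.
    rewrite ev_sub evMn ev_reindex.
    rewrite (_ : ev _ q *+ p = ev w q) ?subrr; first exact: sZ.1.
    rewrite -evMn; apply: ev_eq => i.
    by rewrite coefMn -mulr_natr natz mulrC mulrzA -pmulrn wsg.
  - split; first by exists 0; rewrite !ev0.
    by move=> _ _ [c ->] [d ->]; exists (c - d); rewrite !ev_sub.
  - move=> u v [c [-> ->]]; split; last by exists (reindex ta c); rewrite ev_reindex.
    apply: ev_subgroup => // i; apply: subgroup_mulz => //; apply: subgroup_muln => //.
    by exists 'X^i; rewrite evXn.
  - move=> v [c [/esym/indY pc ->]]; apply/TZ; apply: (ev_subgroup sZ) => // i.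
    by rewrite wta; apply: prufer_gen_int; rewrite expn1.
  - move=> u v [c [-> ->]] /TZ Z; apply: s10 => l.
    have [n nE] := Z l; apply: (@int_prufer_gen 0 _ n); rewrite -{}nE.
    rewrite /ev coef_sum.
    case: (ltnP l (size c)) => [lc|lc]; last first.
      rewrite nth_default // mul0r big1 // => i _; rewrite wta prufer_gen_coef.
      by rewrite (gtn_eqF (leq_trans (ltn_ord i) lc)) mul0r.
    rewrite (bigD1 (Ordinal lc)) //= wta prufer_gen_coef eqxx mul1r big1 ?addr0 // => i il.
    rewrite wta prufer_gen_coef (_ : (l == i) = false) ?mul0r //.
    by apply/negbTE; rewrite eq_sym; exact: il.
  - move=> _ [q ->] /(independent_ev_socle b0 Yb indY) pq.
    pose c := \poly_(i < size q) (q`_i %/ (p ^ (b i).-1)%:Z)%Z.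
    exists (ev (fun i => Y (ta i)) c), c; congr (_, _); apply: ev_eq => i.
    rewrite coef_poly; case: ltnP => iq; last by rewrite nth_default // !mulr0z.
    by rewrite {1}(dvdz_quo (pq i)) mulrzA -pmulrn.
have [D [sD [sumD [HD essD]]]] := sgb H sH emb.
(* The images of [x] and [p Y (sg 0)] agree, so [x - p Y (sg 0)] lies in [H]. *)
apply: (@no_essential_summand H D a x (- Y (sg 0%N)) sH) => //.
  exists (1 - 'X^(sg 0%N) *+ p); rewrite !ev_sub !evMn -(expr0 'X) !evXn wsg mulNrn.
  by split=> //; rewrite subrr; apply: sZ.1.
move=> _ [q [-> Zq]] /(independent_ev_socle b0 Yb indY) pq.
(* On the socle all terms other than the one of [x] are sent to 0; hence so is that one, and it
   vanishes because [x] is mapped injectively. *)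
have Z0 : int_poly (w 0%N *~ q`_0).
  move: Zq; rewrite ev_recl => Zq.
  rewrite -(addrK (ev (fun i => w i.+1) (drop_poly 1 q)) (w 0%N *~ _)); apply: sZ.2 => //.
  apply: (ev_subgroup sZ) => // i; apply: prufer_gen_int; rewrite coef_drop_poly addn1.
  by apply: dvdz_trans (pq i.+1); rewrite dvdzE /= dvdn_exp2l // /h leq_addl.
have q0 : ((p ^ a)%:Z %| q`_0)%Z.
  have [n] := Z0 0%N; rewrite prufer_gen_coef /= mul1r => /int_prufer_gen.
  by rewrite prednK.
rewrite ev_recl (dvdz_quo q0) mulrzA -pmulrn xa mul0rz add0r.
apply: ev_subgroup (pow_subgroup a) _ => i; rewrite coef_drop_poly addn1.
rewrite (dvdz_quo (pq i.+1)) mulrzA -pmulrn; apply: subgroup_mulz (pow_subgroup a) _.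
by apply: (@pow_le _ (h i)); [rewrite /h leq_addr | apply: powX].
Qed.

(** * Shifting a homogeneous summand *)

Lemma evMz (V : zmodType) (y : nat -> V) q (c : int) : ev y (q *~ c) = ev y q *~ c.
Proof. exact: raddfMz. Qed.

(* [e] shifts a homogeneous summand with basis [y0 = y 0, y 1, ...] by one place. *)
Record shift_endo k y0 (e : G -> G) : Prop := ShiftEndo {
  shift_base_exp : y0 *+ p ^ k = 0;
  shift_base_height : ~ pow k (y0 *+ p ^ k.-1);
  shift_sub : {morph e : x y / x - y};
  shift_inj : forall x, e x = 0 -> x = 0;
  shift_id : forall x, pow k x -> e x = x;
  shift_avoid : forall w (c : int), e w = y0 *~ c -> y0 *~ c = 0 }.

(** Choose [y i] with the [p^(k-1) y i] independent modulo the finite [(p^k G)[p]]. Their span [M],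
    a sum of copies of [Z(p^k)], is pure and bounded, hence has a complement [L] containing [p^k G];
    [e] shifts [M] and fixes [L]. *)
Lemma exists_shift_endo k : (0 < k)%N ->
  ~ finite_set (fun z : G => pow k.-1 z /\ z *+ p = 0) ->
  finite_set (fun z : G => pow k z /\ z *+ p = 0) -> exists y0 e, shift_endo k y0 e.
Proof.
move=> k0 inf fin.
have sk := pow_subgroup k.
have sS : subgroup (fun z : G => pow k z /\ z *+ p = 0).
  split; first by split; [apply: sk.1 | rewrite mul0rn].
  by move=> u v [ku pu] [kv pv]; split; [apply: sk.2 | rewrite mulrnBl pu pv subrr].
have [|_|s [sS' sI]] := @independent_sequence _ (fun _ z => pow k.-1 z /\ z *+ p = 0) sS fin.
- by move=> _ z [].
- exact: inf.
have /choice[y yE] : forall i, exists y, s i = y *+ p ^ k.-1 by move=> i; case: (sS' i).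
have ps i : s i *+ p = 0 by case: (sS' i).
have yk i : y i *+ p ^ k = 0 by rewrite -(prednK k0) -mulrnX1 -yE.
have sk1 q : ev (fun i => y i *+ p ^ k.-1) q = ev s q by apply: ev_eq => i; rewrite yE.
have sI' q : pow k (ev s q) -> forall i, (p%:Z %| q`_i)%Z.
  move=> kq; apply: sI; split=> //; rewrite ev_muln.
  by apply: (ev_subgroup (subgroup_zero G)) => i; rewrite ps mul0rz.
have indy q : ev (fun i => y i *+ p ^ k.-1) q = 0 -> forall i, (p%:Z %| q`_i)%Z.
  by rewrite sk1 => E; apply: sI'; rewrite E; apply: sk.1.
have evy0 q : ev y q = 0 <-> (forall i, ((p ^ k)%:Z %| q`_i)%Z).
  split=> [|kq]; first exact: (@independent_ev y (fun=> k) (fun=> k0) yk indy).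
  apply: (ev_subgroup (subgroup_zero G)) => i.
  by rewrite (dvdz_quo (kq i)) mulrzA -pmulrn yk mul0rz.
pose M z := exists q, z = ev y q.
have sM : subgroup M.
  split; first by exists 0; rewrite ev0.
  by move=> _ _ [q ->] [r ->]; exists (q - r); rewrite ev_sub.
pose dq j q := \poly_(i < size q) (q`_i %/ (p ^ j)%:Z)%Z.
have dqE j q i : ((p ^ j)%:Z %| q`_i)%Z -> q`_i = (p ^ j)%:Z * (dq j q)`_i.
  move=> jq; rewrite coef_poly; case: ltnP => iq; last by rewrite nth_default // mulr0.
  exact: dvdz_quo.
(* Once [p^j] is divided out of the coefficients, multiplying [ev y q] by [p^(k-1-j)] gives a
   combination of the [s i] lying in [p^k G], so [p] divides the quotients. *)
have height j q : (j <= k)%N -> pow j (ev y q) -> forall i, ((p ^ j)%:Z %| q`_i)%Z.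
  elim: j => [|j IHj] jk; first by move=> _ i; rewrite expn0 dvd1z.
  move=> hq; have jq := IHj (ltnW jk) (pow_le (leqnSn j) hq).
  have pd : forall i, (p%:Z %| (dq j q)`_i)%Z.
    apply: sI'; rewrite -sk1.
    rewrite [ev _ _](_ : _ = ev y q *+ p ^ (k.-1 - j)).
      by have := pow_mul (k.-1 - j) hq; rewrite (_ : j.+1 + _ = k)%N //; lia.
    rewrite ev_muln; apply: ev_eq => i; rewrite (dqE j q i (jq i)) mulrzA -pmulrn mulrnXX.
    by rewrite (_ : k.-1 - j + j = k.-1)%N //; lia.
  by move=> i; rewrite (dqE j q i (jq i)) expnSr PoszM dvdz_mul.
have [||L [[_ [sL [ML gen]]] kL]] := @pure_bounded_summand k M sM.
- move=> j _ [q ->] jq; have [jk|kj] := leqP j k.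
    have pq := height j q jk jq; exists (ev y (dq j q)); first by exists (dq j q).
    rewrite ev_muln; apply: ev_eq => i.
    by rewrite {1}(dqE j q i (pq i)) mulrzA -pmulrn.
  have /evy0-> := height k q (leqnn k) (pow_le (ltnW kj) jq).
  by exists 0; rewrite ?mul0rn //; apply: sM.1.
- move=> _ [q ->]; rewrite ev_muln; apply: (ev_subgroup (subgroup_zero G)) => i.
  by rewrite yk mul0rz.
have sep q l : L l -> ev y q + l = 0 -> ev y q = 0 /\ l = 0.
  move=> Ll /eqP; rewrite addr_eq0 => /eqP E; have q0 : ev y q = 0.
    by apply: ML; [exists q | rewrite E; apply: subgroup_opp].
  by split=> //; apply/eqP; rewrite -oppr_eq0 -E q0.
(* Multiplication by ['X] is the shift; the two directions give its injectivity and its independence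
   of [q]. *)
have shq q : ev y ('X * q) = 0 <-> ev y q = 0.
  split=> /evy0 kq; apply/evy0 => i; first by have := kq i.+1; rewrite coefXM.
  by rewrite coefXM; case: i.
have /choice[e eP] : forall x, exists z, exists q l,
    [/\ L l, x = ev y q + l & z = ev y ('X * q) + l].
  by move=> x; have [_ [l [[q ->] [Ll ->]]]] := gen x; exists (ev y ('X * q) + l), q, l.
have eE q l : L l -> e (ev y q + l) = ev y ('X * q) + l.
  move=> Ll; have [q' [l' [Ll' E ->]]] := eP (ev y q + l).
  have [|qq ll] := @sep (q' - q) (l' - l) (sL.2 _ _ Ll' Ll).
    by rewrite ev_sub addrACA -opprD -E subrr.
  have {}ll : l' = l by apply/eqP; rewrite -subr_eq0 ll.
  rewrite ll; congr (_ + _); apply/eqP; rewrite -subr_eq0 -ev_sub -mulrBr.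
  by apply/eqP; apply/shq.
exists (y 0%N), e; split=> //.
- move=> h0; have := @sI' 'X^0; rewrite evXn yE => /(_ h0 0%N); rewrite coefXn /=.
  by rewrite dvdzE /= dvdn1 => /eqP p1; have := p_pr; rewrite p1.
- move=> u v; have [q [l [Ll -> ->]]] := eP u; have [r [m [Lm -> ->]]] := eP v.
  rewrite opprD addrACA -ev_sub eE; last exact: sL.2.
  by rewrite mulrBr ev_sub opprD addrACA.
- move=> u; have [q [l [Ll -> ->]]] := eP u => /(sep _ _ Ll)[/shq -> ->].
  by rewrite addr0.
- by move=> u /kL Lu; have := eE 0 u Lu; rewrite mulr0 ev0 add0r.
(* The constant coefficient of ['X * q - c] is [- c], hence divisible by [p^k]. *)
- move=> u c; have [q [l [Ll _ ->]]] := eP u => /eqP; rewrite -subr_eq0 addrAC.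
  rewrite -[y 0%N]evXn -evMz -ev_sub => /eqP /(sep _ _ Ll)[/evy0 /(_ 0%N) + _].
  rewrite coefB coefXM coefMrz coefXn /= sub0r dvdzE abszN -dvdzE intz evMz evXn => kc.
  by rewrite (dvdz_quo kc) mulrzA -pmulrn yk mul0rz.
Qed.

(** * Two obstructions built from a shift *)

Section Shift.
Variables (k : nat) (y0 : G) (e : G -> G).
Hypotheses (k_gt0 : (0 < k)%N) (she : shift_endo k y0 e).

Lemma shift0 : e 0 = 0.
Proof. by have := shift_sub she 0 0; rewrite !subrr. Qed.

Lemma shiftD : {morph e : x y / x + y}.
Proof.
move=> x y; rewrite -{1}(opprK y) (shift_sub she) -(sub0r y) (shift_sub she) shift0.
by rewrite sub0r opprK.
Qed.

Lemma shiftMn x n : e (x *+ n) = e x *+ n.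
Proof.
elim: n => [|n IHn]; first by rewrite !mulr0n shift0.
by rewrite !mulrS shiftD IHn.
Qed.

Lemma shift_base_neq0 : y0 *+ p ^ k.-1 <> 0.
Proof.
by move=> E; apply: (shift_base_height she); rewrite E; apply: (pow_subgroup k).1.
Qed.

(** Let [H] be generated by [z = x + p y0]. As [a <= k - 2], its socle is generated by
    [p^(k-2) z = p^(k-1) y0], and the image of [e] meets the multiples of [y0] trivially, so [e]
    embeds [G] in [G/H]. *)
Lemma not_sgb_high a x : (0 < a)%N -> x *+ p ^ a = 0 -> ~ pow a (x *+ p ^ a.-1) ->
  (a.+2 <= k)%N -> ~ semi_generalized_bassian G.
Proof.
move=> a0 xa xa1 ak sgb; pose z := x + y0 *+ p.
have y0k := shift_base_exp she.
have xl l : (a <= l)%N -> x *+ p ^ l = 0.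
  by move=> /subnKC <-; rewrite -mulrnXX xa mul0rn.
have zk : z *+ p ^ k.-1 = 0.
  by rewrite mulrnDl mulrn1X prednK // y0k xl ?addr0 //; lia.
have zk1 : z *+ p ^ k.-2 = y0 *+ p ^ k.-1.
  by rewrite mulrnDl mulrn1X xl ?add0r //; [congr (_ *+ p ^ _) | ]; lia.
pose H := adjoin (fun u : G => u = 0) z.
have sH : subgroup H by apply: adjoin_subgroup; apply: subgroup_zero.
have socH h : H h -> h *+ p = 0 -> exists j : int, h = y0 *+ p ^ k.-1 *~ j.
  move=> [_ [j [-> ->]]]; rewrite add0r -(expn1 p) expn_mulz expn1 => ph.
  have : ((p ^ k.-1)%:Z %| p%:Z * j)%Z.
    apply: (@order_dvd z) => //; first by lia.
      by rewrite zk1; apply: shift_base_neq0.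
    by rewrite mulrz_pM.
  have kk : k.-1 = k.-2.+1 by lia.
  rewrite {1}kk expnS PoszM dvdz_mul2l ?p_neq0 //.
  by move=> /dvdzP[i ->]; exists i; rewrite mulrC mulrzA -pmulrn zk1.
have [|D [sD [sumD [HD essD]]]] := sgb H sH.
  exists e; split=> [u v|u v Huv]; first by rewrite shiftD subrr; apply: sH.1.
  apply/eqP; rewrite -subr_eq0; apply/eqP; apply: contrapT => uv0.
  have [i [ni pi]] := @torsion_ladder (fun x => x = 0) (u - v) erefl uv0.
  rewrite -(shift_sub she) in Huv.
  have [|j jE] := socH _ (subgroup_muln (p ^ i) sH Huv).
    by rewrite -!shiftMn pi shift0.
  rewrite -shiftMn [y0 *+ _]pmulrn -mulrzA in jE.
  by apply: ni; apply: (shift_inj she); rewrite jE (shift_avoid she jE).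
apply: (@no_essential_summand H D a x y0 sH) => //; first by exists 0, 1; rewrite add0r.
move=> h Hh /(socH h Hh)[j ->]; apply: subgroup_mulz (pow_subgroup a) _.
by apply: (@pow_le a k.-1); [lia | apply: powX].
Qed.

(** Let [E1] be the socle of the divisible group [p^N G]. Division by [p] embeds [G] in [G/E1];
    composing with [e] embeds it in [G/H], where [H] is [E1] with [y0 + p y] adjoined and
    [p^(k+1) y] is a non-zero element of [E1]. *)
Lemma not_sgb_divisible_part N u : (k <= N)%N ->
  (forall x : G, pow N x -> exists2 y, pow N y & x = y *+ p) -> pow N u -> u <> 0 ->
  ~ semi_generalized_bassian G.
Proof.
move=> kN divN Nu u0 sgb.
have sN := pow_subgroup N; have y0k := shift_base_exp she.
have fixN x : pow N x -> e x = x by move=> Nx; apply: (shift_id she); apply: pow_le Nx.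
have [i [ni pi]] := @torsion_ladder (fun x => x = 0) u erefl u0.
have [y Ny yE] : exists2 y, pow N y & y *+ p ^ k.+1 = u *+ p ^ i.
  elim: k.+1 => [|l [y Ny yE]].
    by exists (u *+ p ^ i); rewrite ?expn0 //; apply: subgroup_muln.
  by have [v Nv vE] := divN y Ny; exists v => //; rewrite -mulrn1X -vE.
pose E1 z := pow N z /\ z *+ p = 0.
have sE1 : subgroup E1.
  split; first by split; [apply: sN.1 | rewrite mul0rn].
  by move=> v w [Nv pv] [Nw pw]; split; [apply: sN.2 | rewrite mulrnBl pv pw subrr].
have [|||||||f [hf injf]] := @embed_quotient E1 (pow N)
    (* The graph of division by [p] on the socle of [p^N G], single-valued modulo [E1]. *)
    (fun z : G * G => [/\ pow N z.1, pow N z.2, z.1 = z.2 *+ p & z.1 *+ p = 0]) sE1 sN.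
- by move=> v [].
- move=> v Nv; have [w Nw wE] := divN v Nv; exists w => //; rewrite wE subrr; exact: sE1.1.
- split; first by split=> //=; rewrite ?mul0rn //; apply: sN.1.
  move=> [v v'] [w w'] [/= Nv Nv' vE pv] [/= Nw Nw' wE pw].
  by split=> /=; [apply: sN.2 | apply: sN.2 | rewrite mulrnBl vE wE | rewrite mulrnBl pv pw subrr].
- by move=> v w [].
- by move=> w [/= _ Nw /esym pw _]; split.
- by move=> v w [/= _ _ -> _] [_].
- by move=> v Nv pv; have [w Nw wE] := divN v Nv; exists w; split.
pose z := y0 + y *+ p; pose H := adjoin E1 z.
have sH : subgroup H by apply: adjoin_subgroup.
have y0j (j : int) : y0 *~ j = 0 -> ((p ^ k)%:Z %| j)%Z.
  by apply: order_dvd => //; apply: shift_base_neq0.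
have Npy (j : int) : pow N (y *+ p *~ j) by apply: subgroup_mulz => //; apply: subgroup_muln.
have HE1 g : H (e g) -> E1 g.
  move=> [t [j [[Nt pt] gE]]].
  have ej : e (g - t - y *+ p *~ j) = y0 *~ j.
    rewrite !(shift_sub she) (fixN t) // (fixN _ (Npy j)) gE /z mulrzDl [_ - t]addrAC.
    by rewrite subrr add0r addrK.
  have /dvdzP[i' jE] := y0j j (shift_avoid she ej).
  have gE' : g - t - y *+ p *~ j = 0 by apply: (shift_inj she); rewrite ej (shift_avoid she ej).
  have -> : g = t + y *+ p *~ j by apply/eqP; rewrite -subr_eq0 opprD addrA gE'.
  split; first exact: subgroup_add.
  rewrite mulrnDl pt add0r jE mulrC mulrzA -pmulrn mulrn1X yE.
  by rewrite -(expn1 p) expn_mulz expn1 pi mul0rz.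
have [|D [sD [sumD [HD essD]]]] := sgb H sH.
  exists (e \o f); split=> [v w|v w] /=; last by rewrite -(shift_sub she) => /HE1 /injf.
  have Evw := hf v w; have [Nvw _] := Evw.
  rewrite -shiftD -(shift_sub she) fixN //.
  by exists (f (v + w) - (f v + f w)), 0; rewrite mulr0z addr0.
apply: (@no_essential_summand H D k y0 y sH) => //.
- exact: shift_base_height she.
- by exists 0, 1; rewrite add0r; split=> //; apply: sE1.1.
move=> _ [t [j [[Nt pt] ->]]].
rewrite mulrnDl pt add0r -(expn1 p) expn_mulz expn1 mulrnDl mulrzDl => E.
have vE : y0 *~ (p%:Z * j) = - (y *+ p *+ p *~ j).
  by apply/eqP; rewrite mulrz_pM -addr_eq0 E.
have Nv : pow N (y *+ p *+ p *~ j) by apply: subgroup_mulz => //; do 2!apply: subgroup_muln => //.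
(* This multiple of [y0] lies in [p^N G], which [e] fixes, so it is in the image of [e] and
   vanishes. Hence [p^(k-1)] divides [j], and the other term, a multiple of [p^(k+1) y], forces one
   more factor [p]. *)
have v0 : y0 *~ (p%:Z * j) = 0.
  apply: (@shift_avoid _ _ _ she (- (y *+ p *+ p *~ j))); rewrite -vE.
  by rewrite fixN // vE; apply: subgroup_opp.
have : ((p ^ k)%:Z %| p%:Z * j)%Z := y0j _ v0.
rewrite -{1}(prednK k_gt0) expnS PoszM dvdz_mul2l ?p_neq0 //.
move=> /dvdzP[j' jE].
have pj' : (p%:Z %| j')%Z.
  apply/negPn/negP => npj; apply: ni; apply: (mulz_unit (subgroup_zero G) pi npj).
  apply/eqP; rewrite -oppr_eq0 -[X in _ == X]v0 vE jE [j' * _]mulrC mulrzA -pmulrn mulrn1X.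
  by rewrite prednK // mulrn1X yE.
have kj : ((p ^ k)%:Z %| j)%Z by rewrite jE -(prednK k_gt0) expnS PoszM dvdz_mul.
apply: (@pow_le k N) => //; apply: subgroup_add => //.
rewrite mulrzDl (dvdz_quo kj) mulrzA -[y0 *~ _]pmulrn y0k mul0rz add0r.
exact: Npy.
Qed.

End Shift.

(** * Bounded groups *)

Definition p_independent e (T X : G -> Prop) : Prop := forall (s : seq G) (c : G -> int),
  uniq s -> (forall x, x \in s -> X x) -> T (\sum_(x <- s) x *+ p ^ e *~ c x) ->
  forall x, x \in s -> (p%:Z %| c x)%Z.

Lemma chain_bound (F : set (set G)) (s : seq G) : total_on F subset ->
  (forall x, x \in s -> exists2 X, F X & X x) ->
  s = [::] \/ exists2 X, F X & forall x, x \in s -> X x.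
Proof.
move=> totF; elim: s => [|x s IHs] Fs; first by left.
right; have [X FX Xx] := Fs x (mem_head _ _).
have [|->|[Y FY Ys]] := IHs; first by move=> z zs; apply: Fs; rewrite inE zs orbT.
  by exists X => // z; rewrite inE => /eqP->.
have [XY|YX] := totF _ _ FX FY.
  by exists Y => // z; rewrite inE => /predU1P[->|/Ys//]; apply: XY.
by exists X => // z; rewrite inE => /predU1P[->//|/Ys]; apply: YX.
Qed.

(** A lift to [A] of an [F_p]-basis of [p^e A] modulo [T], with spanning expressed by test subgroups
    [S]. Were [p^e g] outside [S], [p] would divide the coefficient of [g] in any relation, and [g]
    could be added to [X]. *)
Lemma maximal_p_independent e A T : subgroup T -> (forall g, A g -> T (g *+ p ^ e *+ p)) ->
  exists X, [/\ forall x, X x -> A x, p_independent e T X &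
    forall S, subgroup S -> (forall x, T x -> S x) -> (forall x, X x -> S (x *+ p ^ e)) ->
      forall g, A g -> S (g *+ p ^ e)].
Proof.
move=> sT AT; pose P (X : set G) := (forall x, X x -> A x) /\ p_independent e T X.
have [F FP totF|X [[XA indX] maxX]] := @Zorn_bigcup G P.
  split=> [x [X FX Xx]|s c us sF Tc]; first by have [XA _] := FP _ FX; apply: XA.
  have [->//|[X FX Xs]] := chain_bound totF sF.
  by have [_ indX] := FP _ FX; apply: indX Tc.
exists X; split=> // S sS TS XS g Ag; apply: contrapT => nSg.
have nXg : ~ X g by move=> /XS.
apply: (maxX (fun x => X x \/ x = g)).
  by split=> [x Xx|sub]; [left | apply: nXg; apply: sub; right].
split=> [x [/XA|->]//|s c us sX]; have [gs|gs] := boolP (g \in s); last first.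
  apply: indX => // x xs; case: (sX x xs) => // xg.
  by move: gs; rewrite -xg xs.
have Xrem x : x \in rem g s -> X x.
  by rewrite mem_rem_uniq // inE => /andP[/eqP xg xs]; case: (sX x xs).
rewrite (big_rem g) //= => Tc.
have Sr : S (\sum_(x <- rem g s) x *+ p ^ e *~ c x).
  rewrite big_seq; apply: subgroup_sum => // x /Xrem Xx.
  by apply: subgroup_mulz => //; apply: XS.
have Sg : S (g *+ p ^ e *~ c g).
  rewrite -(addrK (\sum_(x <- rem g s) x *+ p ^ e *~ c x) (_ *~ c g)).
  by apply: sS.2 => //; apply: TS.
have pg : (p%:Z %| c g)%Z.
  apply/negPn/negP => npg; apply: nSg; apply: (mulz_unit sS _ npg Sg).
  by apply: TS; apply: AT.
have Tg : T (g *+ p ^ e *~ c g).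
  by rewrite (dvdz_quo pg) mulrz_pM; apply: subgroup_mulz => //; apply: AT.
have Tr : T (\sum_(x <- rem g s) x *+ p ^ e *~ c x).
  by rewrite -(addKr (g *+ p ^ e *~ c g) (\sum_(x <- _) _)) addrC; apply: sT.2.
have := indX _ c (rem_uniq g us) Xrem Tr => pr x xs.
have [->//|xg] := eqVneq x g; apply: pr; by rewrite mem_rem_uniq // inE xg.
Qed.

Lemma p_independent_family e T X (K : eqType) (v : K -> G) (s : seq K) (c : K -> int) :
  p_independent e T X -> injective v -> (forall k, X (v k)) -> uniq s ->
  T (\sum_(k <- s) v k *+ p ^ e *~ c k) -> forall k, k \in s -> (p%:Z %| c k)%Z.
Proof.
move=> indX vI Xv us Tc.
pose c' g := \sum_(k <- s | v k == g) c k.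
have c'E k : k \in s -> c' (v k) = c k.
  move=> ks; rewrite /c' (eq_bigl (pred1 k)) => [|j]; last by rewrite /= (inj_eq vI).
  by rewrite -big_filter filter_pred1_uniq // big_seq1.
move=> k ks; rewrite -c'E //; apply: (indX (map v s) c') => //; last exact: map_f.
- by rewrite map_inj_uniq.
- by move=> _ /mapP[j _ ->].
- rewrite big_map; move: Tc; congr T.
  by apply: eq_big_seq => j js; rewrite c'E.
Qed.

(** * Direct sums of cyclic groups from a basis *)

Section FreeSum.
Variables (A : G -> Prop) (K : choiceType) (m : K -> nat) (v : K -> G).
Hypotheses (sA : subgroup A) (m_gt1 : forall k, (1 < m k)%N).
Hypotheses (Av : forall k, A (v k)) (vm : forall k, v k *+ m k = 0).
Hypothesis indv : forall (s : seq K) (c : K -> int), uniq s ->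
  \sum_(k <- s) v k *~ c k = 0 -> forall k, k \in s -> ((m k)%:Z %| c k)%Z.
Hypothesis genv : forall S, subgroup S -> (forall k, S (v k)) -> forall x, A x -> S x.

Definition covers (c : K -> nat) (s : seq K) : Prop := forall k, c k <> 0%N -> k \in s.

Lemma list_In_mem (k : K) s : List.In k s -> k \in s.
Proof. by elim: s => //= j s IHs [->|/IHs ks]; rewrite inE ?eqxx ?ks ?orbT. Qed.

Lemma mem_list_In (k : K) s : k \in s -> List.In k s.
Proof. by elim: s => //= j s IHs; rewrite inE => /predU1P[->|/IHs]; [left | right]. Qed.

Lemma covers_sum c s t : uniq s -> uniq t -> covers c s -> covers c t ->
  \sum_(k <- s) v k *+ c k = \sum_(k <- t) v k *+ c k.
Proof.
move=> us ut cs ct.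
have red r : \sum_(k <- r) v k *+ c k = \sum_(k <- [seq k <- r | c k != 0%N]) v k *+ c k.
  rewrite big_filter [RHS]big_mkcond; apply: eq_bigr => k _.
  by case: eqP => [->|].
rewrite red [RHS]red; apply: perm_big; apply: uniq_perm; rewrite ?filter_uniq // => k.
by rewrite !mem_filter; case: eqP => //= /[dup] /cs -> /ct ->.
Qed.

(** Some finite list outside which [c] vanishes, not the exact support; by [covers_sum] the sum does
    not depend on it. *)
Definition supp c : seq K := undup (xget [::] [set s | covers c s]).

Definition dsum_eval c : G := \sum_(k <- supp c) v k *+ c k.

Lemma supp_covers c : dsum_elem m c -> covers c (supp c).
Proof.
move=> [_ [s cs]] k ck; rewrite mem_undup.
have := @xgetPex _ [::] [set s | covers c s]; apply=> //.
by exists s => j /cs /list_In_mem.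
Qed.

Lemma dsum_evalE c s : dsum_elem m c -> uniq s -> covers c s ->
  dsum_eval c = \sum_(k <- s) v k *+ c k.
Proof. by move=> mc us cs; apply: covers_sum => //; [apply: undup_uniq | apply: supp_covers]. Qed.

Lemma dsum_add_elem c d : dsum_elem m c -> dsum_elem m d -> dsum_elem m (dsum_add m c d).
Proof.
move=> [_ [s cs]] [_ [t dt]]; split=> [k|]; first by rewrite ltn_mod ltnW.
exists (s ++ t) => k ck; apply: mem_list_In; rewrite mem_cat.
have [c0|/eqP/cs/list_In_mem-> //] := eqVneq (c k) 0%N.
have [d0|/eqP/dt/list_In_mem-> //] := eqVneq (d k) 0%N; last by rewrite orbT.
by case: ck; rewrite /dsum_add c0 d0 mod0n.
Qed.

Lemma common_cover c d : dsum_elem m c -> dsum_elem m d ->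
  exists s, [/\ uniq s, covers c s & covers d s].
Proof.
move=> mc md; exists (undup (supp c ++ supp d)); split; first exact: undup_uniq.
  by move=> k /(supp_covers mc) ks; rewrite mem_undup mem_cat ks.
by move=> k /(supp_covers md) ks; rewrite mem_undup mem_cat ks orbT.
Qed.

Lemma dsum_evalD c d : dsum_elem m c -> dsum_elem m d ->
  dsum_eval (dsum_add m c d) = dsum_eval c + dsum_eval d.
Proof.
move=> mc md; have [s [us cs ds]] := common_cover mc md.
rewrite !(@dsum_evalE _ s) //; last first.
- move=> k ck; have [c0|/eqP/cs//] := eqVneq (c k) 0%N.
  have [d0|/eqP/ds//] := eqVneq (d k) 0%N.
  by case: ck; rewrite /dsum_add c0 d0 mod0n.
- exact: dsum_add_elem.
rewrite -big_split; apply: eq_bigr => k _ /=; rewrite /dsum_add -mulrnDr.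
by rewrite {2}(divn_eq (c k + d k) (m k)) mulrnDr mulnC mulrnA vm mul0rn add0r.
Qed.

Lemma dsum_eval_inj c d : dsum_elem m c -> dsum_elem m d -> dsum_eval c = dsum_eval d -> c = d.
Proof.
move=> mc md; have [s [us cs ds]] := common_cover mc md.
rewrite !(@dsum_evalE _ s) // => /eqP; rewrite -subr_eq0 -sumrB => /eqP E.
have ind := @indv s (fun k => (c k)%:Z - (d k)%:Z) us.
have {}ind k : k \in s -> (m k %| (c k)%:Z - (d k)%:Z)%Z.
  by apply: ind; rewrite -[RHS]E; apply: eq_bigr => j _; rewrite mulrzBr -!pmulrn.
apply/funext => k; have [ks|ks] := boolP (k \in s); last first.
  have c0 : c k = 0%N by apply/eqP; apply: contraNT ks => /eqP; apply: cs.
  have d0 : d k = 0%N by apply/eqP; apply: contraNT ks => /eqP; apply: ds.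
  by rewrite c0 d0.
have := ind k ks; rewrite -eqz_mod_dvd => /eqP.
by rewrite !modz_nat !modn_small ?mc.1 ?md.1 // => -[].
Qed.

Lemma dsum_eval_gen x : A x -> exists c, dsum_elem m c /\ dsum_eval c = x.
Proof.
pose im x := exists c, dsum_elem m c /\ dsum_eval c = x.
have m_gt0 k : (0 < m k)%N by rewrite ltnW.
apply: (genv (S := im)) => [|k].
  have im0 : im 0 by exists (fun=> 0%N); split; [apply: dsum_elem0 | apply: dsum_morph0 dsum_evalD].
  split=> // _ _ [c [mc <-]] [d [md <-]].
  have [r dr] := pG (dsum_eval d).
  (* In a torsion group opposites are natural multiples, so closure under addition suffices. *)
  have -> : - dsum_eval d = dsum_eval d *+ (p ^ r).-1.
    apply/esym/eqP; rewrite -addr_eq0 addrC -mulrS prednK ?dr // expn_gt0 prime_gt0 //.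
  have [md' ->] := dsum_morph_muln m_gt0 dsum_evalD (p ^ r).-1 md.
  by rewrite -dsum_evalD //; eexists; split; [apply: dsum_add_elem mc md' | ].
pose c j := nat_of_bool (j == k).
have mc : dsum_elem m c.
  split=> [j|]; first by rewrite /c; case: eqP.
  by exists [:: k] => j; rewrite /c; case: eqP => // ->; left.
exists c; split=> //; rewrite (@dsum_evalE _ [:: k]) //; first by rewrite big_seq1 /c eqxx.
by move=> j; rewrite /c; case: eqP => // -> _; rewrite mem_head.
Qed.

Lemma iso_to_dsum_of_basis : iso_to_dsum A m.
Proof.
exists dsum_eval; split; first by move=> c _; apply: subgroup_sum => // k _; apply: subgroup_muln.
split; first exact: dsum_evalD.
by split; [apply: dsum_eval_inj | apply: dsum_eval_gen].
Qed.

End FreeSum.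

(** * Sums of copies of [Z(p^n)] and [Z(p^(n+1))] *)

Definition getl (I J : Type) (k : I + J) : option I := if k is inl i then Some i else None.
Definition getr (I J : Type) (k : I + J) : option J := if k is inr j then Some j else None.

Lemma big_sum_type (I J : eqType) (s : seq (I + J)) (F : I + J -> G) :
  \sum_(k <- s) F k =
  \sum_(i <- pmap (@getl I J) s) F (inl i) + \sum_(j <- pmap (@getr I J) s) F (inr j).
Proof.
elim: s => [|[i|j] s IHs] /=; first by rewrite !big_nil addr0.
  by rewrite !big_cons IHs addrA.
by rewrite !big_cons IHs addrCA.
Qed.

(** By induction, [p^r] divides all coefficients of a relation for [r <= n]. Divide by [p^r]:
    scaling by [p^n] kills the [XI] part and treats [XJ]; scaling by [p^(n-1)] then puts the [XJ]
    part in [p^n A] and treats [XI]. One more step for [XJ] remains at [r = n]. *)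
Lemma two_orders_basis A n (XI XJ : G -> Prop) : (0 < n)%N ->
  subgroup A -> (forall x, A x -> x *+ p ^ n.+1 = 0) ->
  (forall x, XI x -> A x /\ x *+ p ^ n = 0) -> (forall x, XJ x -> A x) ->
  p_independent n.-1 (pmul A n) XI -> p_independent n (fun x => x = 0) XJ ->
  (forall S, subgroup S -> (forall x, XI x -> S x) -> (forall x, XJ x -> S x) ->
    forall x, A x -> S x) ->
  exists I J : Type, iso_to_dsum A (@two_orders p n I J).
Proof.
move=> n0 sA expA XIA XJA indI indJ gen.
pose I := {x : G | `[< XI x >]}; pose J := {x : G | `[< XJ x >]}.
exists I, J; pose v (k : I + J) := match k with inl i => val i | inr j => val j end.
have XIv (i : I) : XI (val i) by apply/asboolP; exact: (valP i).
have XJv (j : J) : XJ (val j) by apply/asboolP; exact: (valP j).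
have Av k : A (v k).
  by case: k => [i|j]; [exact: (XIA _ (XIv i)).1 | exact: (XJA _ (XJv j))].
have vI (i : I) : v (inl i) *+ p ^ n = 0 := (XIA _ (XIv i)).2.
apply: (@iso_to_dsum_of_basis _ (I + J)%type _ v) => //.
- have pl l : (0 < l)%N -> (1 < p ^ l)%N.
    by move=> l0; apply: leq_ltn_trans l0 (ltn_expl _ (prime_gt1 p_pr)).
  by case=> k; apply: pl.
- by case=> k /=; [apply: vI | apply: expA; exact: (Av (inr k))].
- move=> s c us E.
  have uI : uniq (pmap (@getl I J) s) by apply: (pmap_uniq (g := inl)) => // -[].
  have uJ : uniq (pmap (@getr I J) s) by apply: (pmap_uniq (g := inr)) => // -[].
  have sI i : inl i \in s -> i \in pmap (@getl I J) s.
    by move=> si; rewrite mem_pmap; apply/mapP; exists (inl i).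
  have sJ j : inr j \in s -> j \in pmap (@getr I J) s.
    by move=> js; rewrite mem_pmap; apply/mapP; exists (inr j).
  pose d r k := (c k %/ (p ^ r)%:Z)%Z.
  have cd r k : ((p ^ r)%:Z %| c k)%Z -> c k = (p ^ r)%:Z * d r k by apply: dvdz_quo.
  have scaled r l : (r <= l)%N -> (forall k, k \in s -> ((p ^ r)%:Z %| c k)%Z) ->
      \sum_(i <- pmap (@getl I J) s) v (inl i) *+ p ^ l *~ d r (inl i) +
      \sum_(j <- pmap (@getr I J) s) v (inr j) *+ p ^ l *~ d r (inr j) = 0.
    move=> rl pc; rewrite -(big_sum_type s (fun k => v k *+ p ^ l *~ d r k)).
    rewrite -[RHS](mul0rn _ (p ^ (l - r))) -[in RHS]E -sumrMnl; apply: eq_big_seq => k ks.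
    by rewrite [in RHS](cd r k (pc k ks)) mulrzA -pmulrn expn_mulz mulrnXX subnKC.
  have stepJ r : (r <= n)%N -> (forall k, k \in s -> ((p ^ r)%:Z %| c k)%Z) ->
      forall j, inr j \in s -> (p%:Z %| d r (inr j))%Z.
    move=> rn pc j js.
    apply: (p_independent_family indJ val_inj XJv uJ _ (sJ j js) (c := fun j => d r (inr j))).
    rewrite -[RHS](scaled r n rn pc) [X in _ = X + _]big1 ?add0r // => i _.
    by rewrite vI mul0rz.
  have stepI r : (r < n)%N -> (forall k, k \in s -> ((p ^ r)%:Z %| c k)%Z) ->
      forall i, inl i \in s -> (p%:Z %| d r (inl i))%Z.
    move=> rn pc i si; have pJ := stepJ r (ltnW rn) pc.
    apply: (p_independent_family indI val_inj XIv uI _ (sI i si) (c := fun i => d r (inl i))).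
    have /eqP := scaled r n.-1 ltac:(lia) pc; rewrite addr_eq0 => /eqP->.
    apply: subgroup_opp; first exact: pmul_subgroup.
    rewrite big_seq; apply: subgroup_sum; first exact: pmul_subgroup.
    move=> j; rewrite mem_pmap => /mapP[[//|j'] js [jj']]; rewrite {}jj'.
    rewrite (dvdz_quo (pJ j' js)) mulrz_pM mulrnX1 prednK //.
    by apply: subgroup_mulz; [apply: pmul_subgroup | exists (v (inr j'))].
  have all_n r : (r <= n)%N -> forall k, k \in s -> ((p ^ r)%:Z %| c k)%Z.
    elim: r => [|r IHr] rn k ks; first by rewrite expn0 dvd1z.
    have pc := IHr (ltnW rn); rewrite (cd r k (pc k ks)) expnSr PoszM dvdz_mul //.
    by case: k ks => [i|j] ks; [apply: stepI | apply: stepJ => //; apply: ltnW].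
  have pc := all_n n (leqnn n).
  case=> [i|j] ks; first exact: pc.
  rewrite (cd n _ (pc _ ks)) [two_orders _ _ _]/= expnSr PoszM dvdz_mul //.
  exact: stepJ.
- move=> S sS Sv; apply: gen => // x Xx.
    by have := Sv (inl (exist _ x (asboolT Xx))).
  by have := Sv (inr (exist _ x (asboolT Xx))).
Qed.

(** The basis lifts [F_p]-bases of [p^n A] and of [p^(n-1) A[p^n]] modulo [p^n A]. If [S] contains
    it, then [A = S + p A]; iterating, [A = S + p^(n+1) A = S]. *)
Lemma two_orders_decomposition A n : (0 < n)%N -> subgroup A ->
  (forall x, A x -> x *+ p ^ n.+1 = 0) -> (forall x, A x -> x *+ p = 0 -> pmul A n.-1 x) ->
  exists I J : Type, iso_to_dsum A (@two_orders p n I J).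
Proof.
move=> n0 sA expA socA.
have [|XJ [XJA indJ genJ]] := @maximal_p_independent n A _ (subgroup_zero G).
  by move=> g Ag; rewrite mulrnX1; apply: expA.
have [|XI [XIA indI genI]] :=
  @maximal_p_independent n.-1 (fun x => A x /\ x *+ p ^ n = 0) _ (pmul_subgroup n sA).
  by move=> g [_ gn]; rewrite mulrnX1 prednK // gn; apply: (pmul_subgroup n sA).1.
apply: (two_orders_basis n0 sA expA XIA XJA indI indJ) => S0 sS0 SI SJ.
pose S x := S0 x /\ A x.
have sS : subgroup S.
  split; first by split; [apply: sS0.1 | apply: sA.1].
  by move=> x y [Sx Ax] [Sy Ay]; split; [apply: sS0.2 | apply: sA.2].
have low j x : (j < n)%N -> A x -> x *+ p ^ j = 0 -> pmul A 1 x.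
  elim: j x => [|j IHj] x jn Ax xj.
    by rewrite -[x]mulr1n -(expn0 p) xj; apply: (pmul_subgroup 1 sA).1.
  have [|w Aw wE] := socA (x *+ p ^ j) (subgroup_muln _ sA Ax); first by rewrite mulrnX1.
  have Aw' : pmul A 1 (w *+ p ^ (n.-1 - j)).
    exists (w *+ p ^ (n.-1 - j.+1)); first exact: subgroup_muln.
    by rewrite mulrnXX; congr (_ *+ p ^ _); lia.
  rewrite -(subrK (w *+ p ^ (n.-1 - j)) x); apply: subgroup_add (pmul_subgroup 1 sA) _ Aw'.
  apply: IHj; first exact: ltnW.
    by apply: sA.2 => //; apply: subgroup_muln.
  by rewrite mulrnBl wE mulrnXX subnK ?subrr //; lia.
(* [XJ] corrects [x] to an element killed by [p^n], [XI] corrects that, modulo [p A], to one killed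
   by [p^(n-1)], and [low] puts the rest in [p A]. *)
have split1 x : A x -> exists s u, [/\ S s, A u & x = s + u *+ p].
  move=> Ax.
  have [||d [Sd Ad] dE] := genJ _ (pmul_subgroup n sS) _ _ x Ax.
  - by move=> z ->; apply: (pmul_subgroup n sS).1.
  - by move=> z Xz; exists z => //; split; [apply: SJ | apply: XJA].
  have sS' : subgroup (fun z => exists s u, [/\ S s, A u & z = (s + u *+ p) *+ p ^ n.-1]).
    split; first by exists 0, 0; rewrite mul0rn addr0 mul0rn; split; [apply: sS.1 | apply: sA.1 | ].
    move=> _ _ [s [u [Ss Au ->]]] [t [w [St Aw ->]]]; exists (s - t), (u - w).
    split; [exact: sS.2 | exact: sA.2 | ].
    by rewrite -mulrnBl opprD addrACA -mulrnBl.
  have [|||s [u [Ss Au suE]]] := genI _ sS' _ _ (x - d).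
  - by move=> _ [u Au ->]; exists 0, u; rewrite add0r mulrn1X prednK //; split=> //; apply: sS.1.
  - move=> z Xz; exists z, 0; rewrite mul0rn addr0; split=> //; last exact: sA.1.
    by split; [apply: SI | case: (XIA z Xz)].
  - by split; [apply: sA.2 | rewrite mulrnBl dE subrr].
  have [|||w Aw wE] := low n.-1 (x - d - (s + u *+ p)).
  - by lia.
  - by apply: sA.2; [apply: sA.2 | apply: subgroup_add => //; [case: Ss | apply: subgroup_muln]].
  - by rewrite mulrnBl suE subrr.
  exists (d + s), (u + w); split; [exact: subgroup_add | exact: subgroup_add | ].
  rewrite mulrnDl -(expn1 p) -wE expn1 -[d + s + _]addrA [s + (_ + _)]addrA.
  by rewrite [s + _ + _]addrC subrK addrC subrK.
have splitk k x : A x -> exists s u, [/\ S s, A u & x = s + u *+ p ^ k].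
  elim: k x => [|k IHk] x Ax; first by exists 0, x; rewrite add0r; split=> //; apply: sS.1.
  have [s [u [Ss Au ->]]] := IHk x Ax; have [t [w [St Aw ->]]] := split1 u Au.
  exists (s + t *+ p ^ k), w; split=> //.
    by apply: subgroup_add => //; apply: subgroup_muln.
  by rewrite mulrnDl mulrn1X addrA.
move=> x Ax; have [s [u [[Ss _] Au ->]]] := splitk n.+1 x Ax.
by rewrite expA // addr0.
Qed.

Lemma condition3_of_bounded n N : (0 < n)%N -> (forall x : G, x *+ p = 0 -> pow n.-1 x) ->
  (forall x : G, x *+ p ^ N = 0) -> finite_set (fun x : G => pow n.+1 x /\ x *+ p = 0) ->
  condition3 G p.
Proof.
move=> n0 socn expN fin.
have sT : subgroup (fun _ : G => True) by [].
have [|D [[sD _] _ DW neat maxD]] := @neat_hull (fun=> True) (fun x => x = 0)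
  (fun t => pow n.+1 t -> t = 0) sT (subgroup_zero G) (fun _ _ => I); first by [].
have neatD y : D (y *+ p) -> exists2 d, D d & y *+ p = d *+ p by apply: neat.
have sn := pow_subgroup n.+1.
have Dn x : D x -> pow n.+1 x -> x = 0.
  move=> Dx nx; apply: contrapT => x0.
  have [i [ni pi]] := @torsion_ladder (fun x => x = 0) x erefl x0.
  by apply: ni; apply: DW => //; apply: subgroup_muln.
have [C [DC nC]] := neat_summand socn sD neatD Dn.
have [_ [sC [dis gen]]] := DC.
(* Were [t] outside [p^(n+1) G], adjoining it to [D] would keep the intersection with [p^(n+1) G]
   trivial, because [C] contains [p^(n+1) G]; so [t] would lie in both [D] and [C]. *)
have Csoc t : C t -> t *+ p = 0 -> pow n.+1 t.
  move=> Ct pt; apply: contrapT => nt; apply: (nt); rewrite (dis t) //; first exact: sn.1.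
  apply: maxD => // d a Dd _ da.
  have d0 : d = 0.
    apply: dis => //; rewrite -(addrK (t *~ a) d); apply: sC.2; [exact: nC | exact: subgroup_mulz].
  move: da; rewrite d0 add0r => ta.
  have [pa|npa] := boolP (p%:Z %| a)%Z; first by rewrite (dvdz_quo pa) mulrz_pM pt mul0rz.
  by case: nt; apply: (mulz_unit sn _ npa ta); rewrite pt; apply: sn.1.
have expD x : D x -> x *+ p ^ n.+1 = 0.
  by move=> Dx; apply: Dn; [apply: subgroup_muln | apply: powX].
have [|I [J isoD]] := two_orders_decomposition n0 sD expD.
  by move=> x Dx /socn; apply: neat_pure socn sD neatD Dn _ _ Dx.
exists n; split=> //; exists D, C, I, J; split=> //; split=> //; split.
  have [|s sP] := @finite_torsion C N sC; last by exists s => x Cx; apply: sP.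
  by apply: finite_setS fin => x [Cx px]; split=> //; apply: Csoc.
by move=> y Cy py; apply: Csoc.
Qed.

(** * Necessity *)

Lemma nat_min (P : nat -> Prop) : (exists n, P n) ->
  exists n, P n /\ forall m, (m < n)%N -> ~ P m.
Proof.
move=> [n Pn]; have exP : exists n, `[< P n >] by exists n; apply/asboolP.
case: (ex_minnP exP) => m /asboolP Pm minm; exists m; split=> // l lm Pl.
by have := minm l (asboolT Pl); rewrite leqNgt lm.
Qed.

(** By minimality of [a], everything killed by [p^(a-1)] is in [p G]. If [p^(a-1) x = p^a w], this
    applies to [x - p w]; a socle element [p^j u] with [j < a - 1] has [u] in [p G], which raises
    its height step by step. *)
Lemma minimal_pure_element : ~ divisible G -> exists a x, [/\ (0 < a)%N, x *+ p ^ a = 0,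
  ~ pow a (x *+ p ^ a.-1) & forall t : G, t *+ p = 0 -> pow a.-1 t].
Proof.
move=> ndiv; have [x0 nx0] : exists x, ~ pow 1 x.
  apply: contrapT => nex; apply: ndiv; apply: divisible_of_p => x.
  by apply: contrapT => nx; apply: nex; exists x.
have [|a [[x [xa nx]] mina]] := @nat_min (fun a => exists x, x *+ p ^ a = 0 /\ ~ pow 1 x).
  by have [k xk] := pG x0; exists k, x0.
have s1 := pow_subgroup 1.
have low j z : (j < a)%N -> z *+ p ^ j = 0 -> pow 1 z.
  by move=> ja zj; apply: contrapT => nz; apply: (mina j ja); exists z.
have a0 : (0 < a)%N.
  by case: a xa {mina low} => //; rewrite expn0 mulr1n => x00; case: nx; rewrite x00; apply: s1.1.
exists a, x; split=> // [[w wE]|t pt].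
  apply: nx; rewrite -(subrK (w *+ p) x); apply: subgroup_add => //.
    2: by exists w; rewrite expn1.
  by apply: (low a.-1); [lia | rewrite mulrnBl wE mulrn1X prednK // subrr].
suff: forall j, (j <= a.-1)%N -> pow j t by apply.
elim=> [|j IHj] ja; first exact: pow0.
have [u uE] := IHj (ltnW ja).
have [||w wE] := low j.+1 u; first by lia.
  by rewrite -mulrnX1 -uE.
by exists w; rewrite uE wE mulrnXX add1n.
Qed.

Lemma sgb_necessary : semi_generalized_bassian G ->
  divisible G \/ finite_p_rank G p \/ condition3 G p.
Proof.
move=> sgb; have [?|ndiv] := pselect (divisible G); first by left.
right; have [?|nfin] := pselect (finite_p_rank G p); [by left | right].
have [a [x [a0 xa xa1 soca]]] := minimal_pure_element ndiv.
pose fin k := finite_set (fun z : G => pow k z /\ z *+ p = 0).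
have [|k [fink mink]] := @nat_min fin.
  apply: contrapT => inf; apply: (not_sgb_unbounded a0 xa xa1 _ sgb) => k fk.
  by apply: inf; exists k.
have k0 : (0 < k)%N.
  case: k fink {mink} => // fin0; case: nfin; apply: finite_setS fin0 => z pz.
  by split=> //; apply: pow0.
have [|y0 [e she]] := exists_shift_endo k0 _ fink; first by apply: mink; lia.
have ka : (k <= a.+1)%N.
  by rewrite leqNgt; apply/negP => ak; apply: (not_sgb_high k0 she a0 xa xa1 ak sgb).
have fina : fin a.+1 by apply: finite_setS fink => z [az pz]; split=> //; apply: pow_le az.
have [N aN stN] := pow_stable fina; have divN := pow_divisible stN.
(* [p^N G] is divisible, so a non-zero [p^N u] is excluded and [p^N] kills [G]. *)
apply: (@condition3_of_bounded a N) => // u; apply: contrapT => u0.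
exact: (not_sgb_divisible_part k0 she (leq_trans ka aN) divN (powX N u) u0 sgb).
Qed.

End PGroup.

Theorem theorem2p11 (p : nat) (G : zmodType) :
  prime p -> p_group G p ->
  (semi_generalized_bassian G <->
     divisible G \/ finite_p_rank G p \/ condition3 G p).
Proof.
move=> p_pr pG; split; first exact: sgb_necessary p_pr pG.
by case=> [?|[?|?]]; [apply: (sgb_divisible p_pr) | apply: (sgb_finite_rank p_pr)
  | apply: (sgb_condition3 p_pr)].
Qed.
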